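(* Given a scalar $\gamma>0$, suppose that the following hold. (1) (Grid bounds.) For the given subintervals $\{\Lambda_i,\ i=1,\dots,N\}$ and the given points $\{\bar h_i,\ i=1,\dots,N\}$, there exist scalars $\sigma_{A,i}>0$, $\sigma_{B,i}>0$, $\sigma_{C,i}>0$, $\sigma_{Q,i}>0$, with $\sigma_{A,i}=\sigma_{C,i}$ for $i=1,\dots,N$, such that $$\|A(\ell)-A_i\|\le\sigma_{A,i},\quad \|B(\ell)-B_i\|\le\sigma_{B,i},\quad \|C(\ell)-C_i\|\le\sigma_{C,i},\quad \|Q(\ell)-Q_i\|\le\sigma_{Q,i}$$ hold for $\mu$-almost all $\ell\in\Lambda_i$ and all $i=1,\dots,N$. (2) (Continuity.) The measure $\mu$ on the Borel sets of $[a,b]$ is the Lebesgue measure; the functions $A\in\mathcal{H}^{n\times n}_\infty$, $B\in\mathcal{H}^{n\times r}_\infty$, $C\in\mathcal{H}^{r\times n}_\infty$ are continuous; and $g(\ell,t)$ is continuous on $[a,b]\times[a,b]$. (3) (Solution and piecewise constant approximation.) For the given $\gamma$, there exists $P\in\mathcal{H}^{n+*}_\infty$ satisfying $\Xi_P(\ell)\gg0$ $\mu$-a.e.; and there exist symmetric positive definite matrices $P_i\in\mathbb{R}^{n\times n}$, $i=1,\dots,N$, such that the piecewise constant function $P_c\in\mathcal{H}^{n+*}_\infty$ defined by $P_c(\ell)=P_i$ for $\ell\in\Lambda_i$, $i=1,\dots,N$, satisfies $\|P-P_c\|_{\mathcal{H}^{n\times n}_\infty}\le\varepsilon_P$, where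 $\varepsilon_P>0$. If the approximation error $\varepsilon_P$ is sufficiently small, then there exist a suitable partition $H=\{h_0,h_1,\dots,h_N\}$ of $[a,b]$ and discrete points $\{\bar h_i,\ i=1,\dots,N\}$ such that the LMI-Problem (defined in the context) is feasible.
   Context: Setting: $\Theta=[a,b]$ with $a<b$ real, and $\mu$ is a measure on its Borel $\sigma$-algebra. Matrices carry the spectral norm $\|\cdot\|$. $\mathcal{H}^{n\times m}_\infty$ is the space of measurable $P:\Theta\to\mathbb{R}^{n\times m}$ with $\|P\|_{\mathcal{H}^{n\times m}_\infty}=\operatorname{ess\,sup}_{\ell\in\Theta}\|P(\ell)\|<\infty$. ''$M(\ell)\gg0$ $\mu$-a.e.'' means that there is $\xi>0$ with $M(\ell)\ge\xi I$ for $\mu$-almost all $\ell$. $\mathcal{H}^{n+*}_\infty$ is the set of symmetric-matrix-valued $P\in\mathcal{H}^{n\times n}_\infty$ with $P(\ell)\gg0$ $\mu$-a.e. $\{\vartheta(k),k\in\mathbb{N}\}$ is a Markov chain in $\Theta$, directly accessible (its value is known at each time), whose initial distribution has a density $\nu_0$ with respect to $\mu$ and whose stochastic kernel has a density $g(\ell,\cdot)$ with respect to $\mu$ for every $\ell\in\Theta$, i.e. $\mathbb{P}(\vartheta(k+1)\in\Lambda\mid\vartheta(k)=\ell)=\int_\Lambda g(\ell,t)\mu(dt)$ for Borel $\Lambda$; moreover $\nu_0(\ell)>0$ $\mu$-a.e. and $\int_\Theta g(t,\ell)\mu(dt)>0$ $\mu$-a.e. The functions $A\in\mathcal{H}^{n\times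 n}_\infty$, $B\in\mathcal{H}^{n\times r}_\infty$, $C\in\mathcal{H}^{r\times n}_\infty$ are the coefficients of the Markov jump linear system $x(k+1)=A(\vartheta(k))x(k)+B(\vartheta(k))v(k)$, $z(k)=C(\vartheta(k))x(k)$. $\mathcal{E}(P)(\ell)=\int_\Theta g(\ell,t)P(t)\mu(dt)$ and $$\Xi_P(\ell)=\begin{bmatrix}\mathcal{E}(P)(\ell)^{-1} & 0 & A(\ell) & B(\ell)\\ 0 & I & C(\ell) & 0\\ A(\ell)^{T} & C(\ell)^{T} & P(\ell) & 0\\ B(\ell)^{T} & 0 & 0 & \gamma I\end{bmatrix}.$$ Grid: a partition $H=\{h_0,\dots,h_N\}$ of $[a,b]$ has $a=h_0<h_1<\dots<h_N=b$; its subintervals are $\Lambda_i=[h_{i-1},h_i)$ for $i=1,\dots,N-1$ and $\Lambda_N=[h_{N-1},h_N]$; one point $\bar h_i\in\Lambda_i$ is selected for each $i$. Further, $q_i(\ell)=\int_{\Lambda_i}g(\ell,t)\mu(dt)$; $Q(\ell)=[\sqrt{q_1(\ell)}I_n\ \ \sqrt{q_2(\ell)}I_n\ \cdots\ \sqrt{q_N(\ell)}I_n]\in\mathbb{R}^{n\times nN}$; $A_i=A(\bar h_i)$, $B_i=B(\bar h_i)$, $C_i=C(\bar h_i)$, $Q_i=Q(\bar h_i)$. LMI-Problem: given scalars $\gamma>0$ and $\sigma_{A,i}>0$, $\sigma_{B,i}>0$, $\sigma_{C,i}>0$, $\sigma_{Q,i}>0$, find, if possible, nonsingular matrices $X_i\in\mathbb{R}^{n\times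 n}$, symmetric positive definite matrices $P_i\in\mathbb{R}^{n\times n}$, and scalars $\alpha_i>0$, $\beta_i>0$, $\rho_i>0$ such that $\Pi^1_i>0$ for all $i=1,\dots,N$; the problem is feasible if such quantities exist. Here $\Upsilon=\mathrm{diag}\{P_1,\dots,P_N\}$ and $\Pi^1_i$ is the symmetric $14\times14$ block matrix with block sizes $(n,r,n,r,nN,r,n,n,n,r,r,nN,n,r)$, with diagonal blocks, in order, $X_i+X_i^T,\ I,\ P_i,\ \gamma I,\ \Upsilon,\ 2\alpha_iI,\ 2\alpha_iI,\ \alpha_iI,\ \beta_iI,\ \beta_iI,\ \beta_iI,\ \rho_iI,\ \rho_iI,\ \rho_iI$, and with the following blocks above the diagonal (position: value): $(1,3)$: $X_iA_i$; $(1,4)$: $X_iB_i$; $(1,5)$: $Q_i\Upsilon$; $(1,7)$: $2\sigma_{A,i}X_i$; $(1,9)$: $\sigma_{B,i}X_i$; $(1,13)$: $\rho_iI$; $(2,3)$: $C_i$; $(2,6)$: $2\sigma_{C,i}I$; $(2,14)$: $\rho_iI$; $(3,8)$: $\alpha_iI$; $(4,11)$: $\beta_iI$; $(5,12)$: $\sigma_{Q,i}\Upsilon$; all other blocks above the diagonal are zero, and the blocks below the diagonal are given by symmetry. *)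

(* Defs.v *)
From HB Require Import structures.
From mathcomp Require Import all_boot all_order all_algebra.
From mathcomp Require Import all_classical all_reals all_analysis measurable_realfun ess_sup_inf.

Set Implicit Arguments.
Unset Strict Implicit.
Unset Printing Implicit Defensive.

Import Order.TTheory GRing.Theory Num.Theory.
Import numFieldNormedType.Exports.

Local Open Scope classical_set_scope.
Local Open Scope ring_scope.

(* Functions on Theta = [a, b] are total functions on R of which only the
   restriction to [a, b] matters; likewise a measure on the Borel sets of
   [a, b] is a Borel measure on R of which only the values at subsets of
   [a, b] matter. *)

Section Matrices.
Context {R : realType}.

Definition enorm n (x : 'cV[R]_n) : R := Num.sqrt (\sum_i x i 0 ^+ 2).

(* Operator norm induced by the Euclidean norms. *)
Definition spectral_norm n m (M : 'M[R]_(n, m)) : R :=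
  sup [set s | exists2 x : 'cV[R]_m, enorm x <= 1 & s = enorm (M *m x)].

Definition sym_psd n (M : 'M[R]_n) : Prop :=
  M^T = M /\ forall x : 'cV[R]_n, 0 <= (x^T *m M *m x) 0 0.

Definition sym_posdef n (M : 'M[R]_n) : Prop :=
  M^T = M /\ forall x : 'cV[R]_n, x != 0 -> 0 < (x^T *m M *m x) 0 0.

End Matrices.

Section FunctionSpaces.
Context {R : realType}.
Variables (a b : R) (mu : {measure set R -> \bar R}).

Definition normHinf n m (P : R -> 'M[R]_(n, m)) : \bar R :=
  ess_sup (mrestr mu (measurable_itv `[a, b]))
          (fun l => (spectral_norm (P l))%:E).

Definition Hinf n m (P : R -> 'M[R]_(n, m)) : Prop :=
  (forall i j, measurable_fun `[a, b] (fun l => P l i j)) /\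
  (normHinf P < +oo)%E.

Definition uniformly_posdef n (M : R -> 'M[R]_n) : Prop :=
  exists2 xi : R, 0 < xi &
    {ae mu, forall l, l \in `[a, b] -> sym_psd (M l - xi%:M)}.

Definition Hinf_plus n (P : R -> 'M[R]_n) : Prop :=
  [/\ Hinf P,
      forall l, l \in `[a, b] -> (P l)^T = P l &
      uniformly_posdef P].

End FunctionSpaces.

Section MarkovChain.
Context {R : realType}.
Variables (a b : R) (mu : {measure set R -> \bar R}).

Definition probability_density (nu : R -> R) : Prop :=
  [/\ measurable_fun `[a, b] nu,
      forall l, l \in `[a, b] -> 0 <= nu l &
      (\int[mu]_(l in `[a, b]) (nu l)%:E = 1)%E].

Definition kernel_density (g : R -> R -> R) : Prop :=
  (forall l, l \in `[a, b] -> probability_density (g l)) /\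
  (forall S : set R, measurable S -> S `<=` `[a, b] ->
     measurable_fun `[a, b] (fun l => (\int[mu]_(t in S) (g l t)%:E)%E : \bar R)).

(* The Markov property with transition kernel g(l, t) mu(dt) is stated on the
   cylinders {theta 0 \in E 0, ..., theta k \in E k}, which form a pi-system
   generating the sigma-algebra of theta 0, ..., theta k. *)
Definition markov_chain_with d (Omega : measurableType d)
    (Pr : probability Omega R) (theta : nat -> {RV Pr >-> R})
    (nu0 : R -> R) (g : R -> R -> R) : Prop :=
  [/\ forall k w, theta k w \in `[a, b],
      probability_density nu0,
      kernel_density g,
      forall S : set R, measurable S -> S `<=` `[a, b] ->
        distribution Pr (theta 0%N) S = (\int[mu]_(l in S) (nu0 l)%:E)%E &
      forall (k : nat) (E : nat -> set R) (S : set R),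
        (forall j, measurable (E j)) -> measurable S -> S `<=` `[a, b] ->
        let past := \bigcap_(j in [set j | (j <= k)%N]) (theta j @^-1` E j) in
        (Pr (past `&` theta k.+1 @^-1` S) =
         \int[Pr]_(w in past) \int[mu]_(t in S) (g (theta k w) t)%:E)%E].

End MarkovChain.

Section LMI.
Context {R : realType}.
Variables (a b : R) (mu : {measure set R -> \bar R}) (g : R -> R -> R).
Variables (n r : nat).

Definition Eop (P : R -> 'M[R]_n) (l : R) : 'M[R]_n :=
  \matrix_(i, j) \int[mu]_(t in `[a, b]) (g l t * P t i j).

Variables (A : R -> 'M[R]_n) (B : R -> 'M[R]_(n, r)) (C : R -> 'M[R]_(r, n)).
Variable gamma : R.

Definition Xi (P : R -> 'M[R]_n) (l : R) : 'M[R]_((n + r) + (n + r)) :=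
  block_mx (block_mx (invmx (Eop P l)) 0 0 1%:M)
           (block_mx (A l) (B l) (C l) 0)
           (block_mx (A l)^T (C l)^T (B l)^T 0)
           (block_mx (P l) 0 0 gamma%:M).

Variable N : nat.

(* Subintervals are numbered from 0: [cell h i] is Lambda_(i+1), and only the
   values h 0, ..., h N are meaningful. *)
Definition cell (h : nat -> R) (i : 'I_N) : set R :=
  [set` if i.+1 == N then `[h i, h i.+1] else `[h i, h i.+1[].

Definition is_partition (h : nat -> R) : Prop :=
  [/\ h 0%N = a, h N = b & forall i, (i < N)%N -> h i < h i.+1].

Definition is_grid (h : nat -> R) (hbar : 'I_N -> R) : Prop :=
  is_partition h /\ forall i, cell h i (hbar i).

Definition cell_prob (h : nat -> R) (j : 'I_N) (l : R) : R :=
  \int[mu]_(t in cell h j) g l t.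

Definition Qmx (h : nat -> R) (l : R) : 'M[R]_(n, \sum_(j < N) n) :=
  \mxrow_(j < N) (Num.sqrt (cell_prob h j l))%:M.

Definition grid_bounds (h : nat -> R) (hbar : 'I_N -> R)
    (sA sB sC sQ : 'I_N -> R) : Prop :=
  forall i : 'I_N,
  [/\ [/\ 0 < sA i, 0 < sB i, 0 < sC i & 0 < sQ i],
      sA i = sC i &
      {ae mu, forall l, cell h i l ->
        [/\ spectral_norm (A l - A (hbar i)) <= sA i,
            spectral_norm (B l - B (hbar i)) <= sB i,
            spectral_norm (C l - C (hbar i)) <= sC i &
            spectral_norm (Qmx h l - Qmx h (hbar i)) <= sQ i]}].

(* The blocks of Pi1 are numbered from 1. *)
Definition Pi1_size (k : nat) : nat :=
  let nN := (\sum_(j < N) n)%N in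
  nth 0%N [:: n; r; n; r; nN; r; n; n; n; r; r; nN; n; r] k.-1.

(* Only the blocks with p <= q are meaningful; Pi1 completes them by symmetry. *)
Definition Pi1_upper (X Ai : 'M[R]_n) (Bi : 'M[R]_(n, r)) (Ci : 'M[R]_(r, n))
    (Qi : 'M[R]_(n, \sum_(j < N) n)) (Pi : 'M[R]_n)
    (Ups : 'M[R]_(\sum_(j < N) n)) (sA sB sC sQ alpha beta rho : R)
    (p q : nat) : 'M[R]_(Pi1_size p, Pi1_size q) :=
  match p as p', q as q' return 'M[R]_(Pi1_size p', Pi1_size q') with
  | 1%N, 1%N => X + X^T
  | 2%N, 2%N => 1%:M
  | 3%N, 3%N => Pi
  | 4%N, 4%N => gamma%:M
  | 5%N, 5%N => Ups
  | 6%N, 6%N => (2 * alpha)%:M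
  | 7%N, 7%N => (2 * alpha)%:M
  | 8%N, 8%N => alpha%:M
  | 9%N, 9%N => beta%:M
  | 10%N, 10%N => beta%:M
  | 11%N, 11%N => beta%:M
  | 12%N, 12%N => rho%:M
  | 13%N, 13%N => rho%:M
  | 14%N, 14%N => rho%:M
  | 1%N, 3%N => X *m Ai
  | 1%N, 4%N => X *m Bi
  | 1%N, 5%N => Qi *m Ups
  | 1%N, 7%N => (2 * sA) *: X
  | 1%N, 9%N => sB *: X
  | 1%N, 13%N => rho%:M
  | 2%N, 3%N => Ci
  | 2%N, 6%N => (2 * sC)%:M
  | 2%N, 14%N => rho%:M
  | 3%N, 8%N => alpha%:M
  | 4%N, 11%N => beta%:M
  | 5%N, 12%N => sQ *: Ups
  | _, _ => 0
  end.

Definition Pi1 (h : nat -> R) (hbar sA sB sC sQ : 'I_N -> R)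
    (X P : 'I_N -> 'M[R]_n) (alpha beta rho : 'I_N -> R) (i : 'I_N) :
    'M[R]_(\sum_(p < 14) Pi1_size p.+1) :=
  let l := hbar i in
  let U := Pi1_upper (X i) (A l) (B l) (C l) (Qmx h l) (P i)
             (\mxdiag_(j < N) P j)
             (sA i) (sB i) (sC i) (sQ i) (alpha i) (beta i) (rho i) in
  \mxblock_(p < 14, q < 14)
    (if (p <= q)%N then U p.+1 q.+1 else (U q.+1 p.+1)^T).

Definition LMI_feasible (h : nat -> R) (hbar sA sB sC sQ : 'I_N -> R) : Prop :=
  exists (X P : 'I_N -> 'M[R]_n) (alpha beta rho : 'I_N -> R),
    forall i : 'I_N,
    [/\ X i \in unitmx,
        sym_posdef (P i),
        [/\ 0 < alpha i, 0 < beta i & 0 < rho i] &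
        sym_posdef (Pi1 h hbar sA sB sC sQ X P alpha beta rho i)].

End LMI.

(* Main.v *)
(** Write [S_i = \sum_j q_j(hbar_i) P_j = Q_i Ups Q_i^T] for the average of the
    piecewise constant approximation, and take [X_i = S_i].  With
    [u = Q_i^T z_1 + z_5] the quadratic form of [Pi1] splits into
    [u^T Ups u], the quadratic form of [Xi] at [(E(P) z_1, z_2, z_3, z_4)] up to
    an error of order [epsP], and terms carrying the multipliers and the grid
    bounds.  Taking all multipliers equal to a small [delta], and then all grid
    bounds equal to an [s] small compared with [delta], completing squares absorbs the
    last group.  Such an [s] is admissible on a fine refinement of the given
    grid, by uniform continuity and
    [\sum_j (sqrt q_j(l) - sqrt q_j(l'))^2 <= \int |g(l, t) - g(l', t)| dt].
    Since [P] is not continuous, each point [hbar_i] is chosen in the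
    full-measure set where all the almost-everywhere hypotheses hold. *)
Require Import Defs.
From HB Require Import structures.
From mathcomp Require Import all_boot all_order all_algebra.
From mathcomp Require Import all_classical all_reals all_analysis measurable_realfun ess_sup_inf.
From mathcomp Require Import ring lra.

Set Implicit Arguments.
Unset Strict Implicit.
Unset Printing Implicit Defensive.

Import Order.TTheory GRing.Theory Num.Theory.
Import numFieldNormedType.Exports.

Local Open Scope classical_set_scope.
Local Open Scope ring_scope.

(** * Euclidean and spectral norms *)

Section Dot.
Context {R : realType}.

Definition dotv n (u v : 'cV[R]_n) : R := (u^T *m v) 0 0.

Lemma dotvE n (u v : 'cV[R]_n) : dotv u v = \sum_i u i 0 * v i 0.
Proof. by rewrite /dotv mxE; apply: eq_bigr => i _; rewrite mxE. Qed.

Lemma dotvC n (u v : 'cV[R]_n) : dotv u v = dotv v u.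
Proof. by rewrite !dotvE; apply: eq_bigr => i _; rewrite mulrC. Qed.

Lemma dotvDr n (u v w : 'cV[R]_n) : dotv u (v + w) = dotv u v + dotv u w.
Proof. by rewrite /dotv mulmxDr mxE. Qed.

Lemma dotvDl n (u v w : 'cV[R]_n) : dotv (u + v) w = dotv u w + dotv v w.
Proof. by rewrite dotvC dotvDr !(dotvC w). Qed.

Lemma dotvZr n (c : R) (u v : 'cV[R]_n) : dotv u (c *: v) = c * dotv u v.
Proof. by rewrite /dotv -scalemxAr mxE. Qed.

Lemma dotvZl n (c : R) (u v : 'cV[R]_n) : dotv (c *: u) v = c * dotv u v.
Proof. by rewrite dotvC dotvZr dotvC. Qed.

Lemma dotvNr n (u v : 'cV[R]_n) : dotv u (- v) = - dotv u v.
Proof. by rewrite -scaleN1r dotvZr mulN1r. Qed.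

Lemma dotvBr n (u v w : 'cV[R]_n) : dotv u (v - w) = dotv u v - dotv u w.
Proof. by rewrite dotvDr dotvNr. Qed.

Lemma dotv0r n (u : 'cV[R]_n) : dotv u 0 = 0.
Proof. by rewrite /dotv mulmx0 mxE. Qed.

Lemma dotv_sumr n (I : finType) (u : 'cV[R]_n) (F : I -> 'cV[R]_n) :
  dotv u (\sum_i F i) = \sum_i dotv u (F i).
Proof. by rewrite /dotv mulmx_sumr summxE. Qed.

Lemma dotv_mulmx n m (M : 'M[R]_(n, m)) (u : 'cV[R]_n) (v : 'cV[R]_m) :
  dotv u (M *m v) = dotv (M^T *m u) v.
Proof. by rewrite /dotv trmx_mul trmxK mulmxA. Qed.

Lemma dotv_form n m (M : 'M[R]_(n, m)) (u : 'cV[R]_n) (v : 'cV[R]_m) :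
  (u^T *m M *m v) 0 0 = dotv u (M *m v).
Proof. by rewrite /dotv mulmxA. Qed.

Lemma dotvv_ge0 n (u : 'cV[R]_n) : 0 <= dotv u u.
Proof. by rewrite dotvE sumr_ge0 // => i _; rewrite -expr2 sqr_ge0. Qed.

Lemma dotvv_eq0 n (u : 'cV[R]_n) : (dotv u u == 0) = (u == 0).
Proof.
apply/idP/eqP => [|->]; last by rewrite dotv0r.
rewrite dotvE psumr_eq0 => [/allP u0|i _]; last by rewrite -expr2 sqr_ge0.
apply/matrixP => i j; rewrite ord1 mxE.
by have /= := u0 i (mem_index_enum _); rewrite mulf_eq0 orbb => /eqP.
Qed.

Lemma enorm_ge0 n (u : 'cV[R]_n) : 0 <= enorm u.
Proof. exact: sqrtr_ge0. Qed.

Lemma sqr_enorm n (u : 'cV[R]_n) : enorm u ^+ 2 = dotv u u.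
Proof.
rewrite sqr_sqrtr ?dotvE; first by apply: eq_bigr => i _; rewrite expr2.
by apply: sumr_ge0 => i _; rewrite sqr_ge0.
Qed.

Lemma enormZ n (c : R) (u : 'cV[R]_n) : enorm (c *: u) = `|c| * enorm u.
Proof.
apply/eqP; rewrite -(eqrXn2 (n := 2)) ?enorm_ge0 ?mulr_ge0 ?enorm_ge0 //.
by rewrite exprMn !sqr_enorm dotvZl dotvZr real_normK ?num_real // expr2 mulrA.
Qed.

Lemma enorm_eq0 n (u : 'cV[R]_n) : (enorm u == 0) = (u == 0).
Proof. by rewrite -dotvv_eq0 -sqr_enorm sqrf_eq0. Qed.

(** Cauchy-Schwarz, from the nonnegative square of [enorm v *: u - enorm u *: v]; changing the sign
    of [u] reduces to a nonnegative product. *)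
Lemma dotv_le_enorm n (u v : 'cV[R]_n) : `|dotv u v| <= enorm u * enorm v.
Proof.
wlog uv : u / 0 <= dotv u v => [hw|].
  have [/hw//|/ltW uv] := leP 0 (dotv u v).
  have := hw (- u); rewrite -scaleN1r dotvZl enormZ mulN1r normrN normrN1 mul1r.
  by apply; rewrite oppr_ge0.
rewrite ger0_norm //.
have [->|u0] := eqVneq u 0.
  by rewrite dotvC dotv0r mulr_ge0 ?enorm_ge0.
have [->|v0] := eqVneq v 0; first by rewrite dotv0r mulr_ge0 ?enorm_ge0.
have pos : 0 < enorm u * enorm v.
  by rewrite mulr_gt0 // lt0r enorm_eq0 enorm_ge0 ?u0 ?v0.
have := dotvv_ge0 (enorm v *: u - enorm u *: v).
rewrite -scaleN1r !(dotvDl, dotvDr, dotvZl, dotvZr) -!sqr_enorm (dotvC v u).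
set s := enorm u in pos *; set t := enorm v in pos *; set c := dotv u v.
move=> h; rewrite -subr_ge0 -(pmulr_rge0 _ pos); lra.
Qed.

(** The squared Frobenius norm serves to bound the set of which [spectral_norm] is the [sup];
    without an upper bound, [sup] is only a default value. *)
Let frob n m (M : 'M[R]_(n, m)) := \sum_i enorm (row i M)^T ^+ 2.

Let enorm_mulmx_frob n m (M : 'M[R]_(n, m)) (x : 'cV[R]_m) :
  enorm (M *m x) <= Num.sqrt (frob M) * enorm x.
Proof.
have F0 : 0 <= frob M by apply: sumr_ge0 => i _; rewrite sqr_ge0.
rewrite -ler_sqr ?nnegrE ?mulr_ge0 ?enorm_ge0 ?sqrtr_ge0 //.
rewrite exprMn (sqr_sqrtr F0) sqr_enorm dotvE /frob mulr_suml.
apply: ler_sum => i _; rewrite -expr2 -exprMn.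
have -> : (M *m x) i 0 = dotv (row i M)^T x.
  by rewrite dotvE mxE; apply: eq_bigr => j _; rewrite !mxE.
rewrite -(real_normK (num_real (dotv _ _))) ler_sqr ?nnegrE //; last first.
  by rewrite mulr_ge0 ?enorm_ge0.
exact: dotv_le_enorm.
Qed.

Lemma enorm0 n : enorm (0 : 'cV[R]_n) = 0.
Proof. by apply/eqP; rewrite enorm_eq0. Qed.

Let spectral_norm_ub n m (M : 'M[R]_(n, m)) :
  has_ubound [set s | exists2 x : 'cV[R]_m, enorm x <= 1 & s = enorm (M *m x)].
Proof.
exists (Num.sqrt (frob M)) => _ [y y1 ->].
apply: le_trans (enorm_mulmx_frob M y) _.
by rewrite ler_piMr ?sqrtr_ge0.
Qed.

Lemma spectral_norm_ge0 n m (M : 'M[R]_(n, m)) : 0 <= spectral_norm M.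
Proof.
rewrite -[leLHS](enorm0 n); apply: (ub_le_sup (spectral_norm_ub M)).
by exists 0; rewrite ?mulmx0 ?enorm0.
Qed.

Lemma enorm_mulmx n m (M : 'M[R]_(n, m)) (x : 'cV[R]_m) :
  enorm (M *m x) <= spectral_norm M * enorm x.
Proof.
have [->|x0] := eqVneq x 0.
  by rewrite mulmx0 !enorm0 mulr0.
have xp : 0 < enorm x by rewrite lt0r enorm_eq0 x0 enorm_ge0.
rewrite -ler_pdivrMr //.
apply: (ub_le_sup (spectral_norm_ub M)).
exists ((enorm x)^-1 *: x).
  by rewrite enormZ ger0_norm ?invr_ge0 ?enorm_ge0 // mulVf // gt_eqF.
by rewrite -scalemxAr enormZ ger0_norm ?invr_ge0 ?enorm_ge0 // mulrC.
Qed.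

Lemma spectral_norm_le n m (M : 'M[R]_(n, m)) (c : R) : 0 <= c ->
  (forall x, enorm (M *m x) <= c * enorm x) -> spectral_norm M <= c.
Proof.
move=> c0 Mc; apply: ge_sup => [|_ [x x1 ->]].
  exists (enorm (M *m 0)), 0 => //.
  by rewrite enorm0.
by apply: le_trans (Mc x) _; rewrite ler_piMr.
Qed.

Lemma spectral_normD n m (M1 M2 : 'M[R]_(n, m)) :
  spectral_norm (M1 + M2) <= spectral_norm M1 + spectral_norm M2.
Proof.
apply: spectral_norm_le => [|x]; first by rewrite addr_ge0 ?spectral_norm_ge0.
rewrite -ler_sqr ?nnegrE ?mulr_ge0 ?addr_ge0 ?spectral_norm_ge0 ?enorm_ge0 //.
rewrite mulmxDl sqr_enorm !dotvDr !dotvDl (dotvC (M2 *m x)) -!sqr_enorm mulrDl.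
have e1 := enorm_mulmx M1 x; have e2 := enorm_mulmx M2 x.
have := le_trans (ler_norm _) (dotv_le_enorm (M1 *m x) (M2 *m x)).
have := enorm_ge0 (M1 *m x); have := enorm_ge0 (M2 *m x).
move: (dotv _ _) (enorm (M1 *m x)) (enorm (M2 *m x)) e1 e2.
move=> c s t; set s' := _ * enorm x; set t' := _ * enorm x => ss tt t0 s0 cst.
have := ler_pM s0 s0 ss ss; have := ler_pM t0 t0 tt tt; have := ler_pM s0 t0 ss tt.
by rewrite -!expr2; lra.
Qed.

Lemma spectral_normN n m (M : 'M[R]_(n, m)) :
  spectral_norm (- M) = spectral_norm M.
Proof.
congr sup; apply/seteqP; split => _ [x x1 ->]; exists x => //;
  by rewrite mulNmx -scaleN1r enormZ normrN1 mul1r.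
Qed.

(** With [y = L^T x], [|y|^2 = <x, L y> <= |x| |L| |y|]; cancelling [|y|] gives one inequality, and
    transposing once more gives the other. *)
Lemma spectral_norm_tr n m (M : 'M[R]_(n, m)) : spectral_norm M^T = spectral_norm M.
Proof.
have le k l (L : 'M[R]_(k, l)) : spectral_norm L^T <= spectral_norm L.
  apply: spectral_norm_le => [|x]; first exact: spectral_norm_ge0.
  have [->|Lx0] := eqVneq (L^T *m x) 0.
    by rewrite enorm0 mulr_ge0 ?spectral_norm_ge0 ?enorm_ge0.
  have Lp : 0 < enorm (L^T *m x) by rewrite lt0r enorm_eq0 Lx0 enorm_ge0.
  rewrite -(ler_pM2l Lp) -expr2 sqr_enorm -dotv_mulmx.
  apply: le_trans (ler_norm _) _; apply: le_trans (dotv_le_enorm _ _) _.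
  rewrite mulrCA mulrC; apply: le_trans (ler_wpM2r (enorm_ge0 x) (enorm_mulmx _ _)) _.
  lra.
by apply/le_anti; rewrite le andTb -{1}(trmxK M) le.
Qed.

Lemma norm_entry_le_enorm n (u : 'cV[R]_n) i : `|u i 0| <= enorm u.
Proof.
rewrite -ler_sqr ?nnegrE ?enorm_ge0 // sqr_enorm dotvE.
rewrite real_normK ?num_real // (bigD1 i) //= -expr2 lerDl.
by apply: sumr_ge0 => j _; rewrite -expr2 sqr_ge0.
Qed.

Lemma norm_entry_le n m (M : 'M[R]_(n, m)) i j : `|M i j| <= spectral_norm M.
Proof.
have -> : M i j = (M *m (delta_mx j 0 : 'cV[R]_m)) i 0 by rewrite -(colE j M) mxE.
apply: le_trans (norm_entry_le_enorm _ _) _.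
apply: le_trans (enorm_mulmx _ _) _; rewrite ler_piMr ?spectral_norm_ge0 //.
rewrite -(expr_le1 (n := 2)) ?enorm_ge0 // sqr_enorm dotvE (bigD1 j) //=.
rewrite !mxE !eqxx /= mulr1 big1 ?addr0 // => k kj.
by rewrite !mxE (negbTE kj) mul0r.
Qed.

(** Links the entrywise closeness given by continuity of a matrix function to closeness in spectral
    norm. *)
Lemma spectral_norm_le_sum n m (M : 'M[R]_(n, m)) :
  spectral_norm M <= \sum_i \sum_j `|M i j|.
Proof.
apply: spectral_norm_le => [|x]; first by apply: sumr_ge0 => i _; apply: sumr_ge0.
have enorm_le_sum k (u : 'cV[R]_k) : enorm u <= \sum_i `|u i 0|.
  rewrite -ler_sqr ?nnegrE ?enorm_ge0 ?sumr_ge0 // sqr_enorm dotvE expr2 mulr_suml.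
  apply: ler_sum => i _; apply: le_trans (ler_norm _) _; rewrite normrM.
  by rewrite ler_wpM2l // (bigD1 i) //= lerDl sumr_ge0.
apply: le_trans (enorm_le_sum _ _) _; rewrite mulr_suml.
apply: ler_sum => i _; rewrite mxE mulr_suml; apply: le_trans (ler_norm_sum _ _ _) _.
apply: ler_sum => j _; rewrite normrM ler_wpM2l //; exact: norm_entry_le_enorm.
Qed.

End Dot.

(** * Quadratic forms of symmetric block matrices *)

Section BlockForm.
Context {R : realType}.

Lemma dotv_submxcol m (p_ : 'I_m -> nat) (x y : 'cV[R]_(\sum_i p_ i)) :
  dotv x y = \sum_i dotv (submxcol x i) (submxcol y i).
Proof.
rewrite /dotv -{1}(submxcolK x) -{1}(submxcolK y) tr_mxcol mul_mxrow_mxcol.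
by rewrite summxE.
Qed.

Lemma dotv_mxblock m (p_ : 'I_m -> nat)
    (M : forall i j : 'I_m, 'M[R]_(p_ i, p_ j)) (x : 'cV[R]_(\sum_i p_ i)) :
  dotv x ((\mxblock_(i, j) M i j) *m x) =
  \sum_i \sum_j dotv (submxcol x i) (M i j *m submxcol x j).
Proof.
rewrite dotv_submxcol; apply: eq_bigr => i _.
rewrite -dotv_sumr; congr dotv.
by rewrite -{1}(submxcolK x) mul_mxblock_mxrow mxcolK.
Qed.

Section SymmetricBlocks.
Variables (m : nat) (p_ : 'I_m -> nat).
Variable U : forall i j : 'I_m, 'M[R]_(p_ i, p_ j).
Hypothesis U_diag : forall i, (U i i)^T = U i i.

Let M i j : 'M[R]_(p_ i, p_ j) := if (i <= j)%N then U i j else (U j i)^T.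

Lemma tr_sym_mxblock : (\mxblock_(i, j) M i j)^T = \mxblock_(i, j) M i j.
Proof.
rewrite tr_mxblock; apply: eq_mxblock => i j; rewrite /M.
case: ltngtP => [||/val_inj ->]; by rewrite ?trmxK ?U_diag.
Qed.

(** The terms [F i j] are symmetric in their indices, so the part below the diagonal repeats the
    part above it. *)
Lemma dotv_sym_mxblock (x : 'cV[R]_(\sum_i p_ i)) :
  dotv x ((\mxblock_(i, j) M i j) *m x) =
  \sum_i (dotv (submxcol x i) (U i i *m submxcol x i) +
    2 * \sum_(j < m | (i < j)%N) dotv (submxcol x i) (U i j *m submxcol x j)).
Proof.
pose F i j := dotv (submxcol x i) (M i j *m submxcol x j).
have FC i j : F i j = F j i.
  rewrite /F dotv_mulmx dotvC; congr (dotv _ (_ *m _)); rewrite /M.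
  by case: ltngtP => [||/val_inj ->]; rewrite ?trmxK ?U_diag.
have Fd i : F i i = dotv (submxcol x i) (U i i *m submxcol x i).
  by rewrite /F /M leqnn.
have Fu (i j : 'I_m) : (i < j)%N -> F i j = dotv (submxcol x i) (U i j *m submxcol x j).
  by move=> ij; rewrite /F /M ltnW.
rewrite dotv_mxblock.
transitivity (\sum_(i < m) (F i i + 2 * \sum_(j < m | (i < j)%N) F i j)); last first.
  apply: eq_bigr => i _; rewrite Fd; congr (_ + 2 * _).
  by apply: eq_bigr => j ij; rewrite Fu.
transitivity (\sum_(i < m) (F i i + \sum_(j < m | (i < j)%N) F i j
                            + \sum_(j < m | (j < i)%N) F i j)).
  apply: eq_bigr => i _; rewrite (bigD1 i) //= -/(F i i) -addrA; congr (_ + _).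
  rewrite (bigID (fun j : 'I_m => (i < j)%N)) /=; congr (_ + _);
    apply: eq_bigl => j.
    by rewrite -(inj_eq val_inj) andbC; case: ltngtP.
  by rewrite -(inj_eq val_inj) /=; case: ltngtP.
have E : \sum_(i < m) \sum_(j < m | (j < i)%N) F i j =
         \sum_(i < m) \sum_(j < m | (i < j)%N) F i j.
  rewrite (exchange_big_dep xpredT) //=; apply: eq_bigr => i _.
  by apply: eq_bigr => j _; rewrite FC.
by rewrite !big_split /= -mulr_sumr E -addrA mulr_natl mulr2n.
Qed.

End SymmetricBlocks.
End BlockForm.

(** * The quadratic form of the LMI matrix *)

Local Notation o k := (@Ordinal 14 k%N isT).

(** Explicit ordinals let the [match] in [Pi1_upper] reduce block by block. *)
Lemma big_ord14 (V : nmodType) (F : 'I_14 -> V) :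
  \sum_(i < 14) F i =
    F (o 0) + (F (o 1) + (F (o 2) + (F (o 3) +
   (F (o 4) + (F (o 5) + (F (o 6) + (F (o 7) +
   (F (o 8) + (F (o 9) + (F (o 10) + (F (o 11) +
   (F (o 12) + F (o 13))))))))))))).
Proof.
rewrite !big_ord_recl big_ord0 addr0 /=.
do !congr (F _ + _); [.. | congr (F _)]; exact: val_inj.
Qed.

Section Pi1Form.
Context {R : realType}.
Variables (gamma : R) (n r N : nat).
Variables (X Ai : 'M[R]_n) (Bi : 'M[R]_(n, r)) (Ci : 'M[R]_(r, n))
    (Qi : 'M[R]_(n, \sum_(j < N) n)) (Pi : 'M[R]_n)
    (Ups : 'M[R]_(\sum_(j < N) n)) (sA sB sC sQ alpha beta rho : R).
Hypotheses (Pi_sym : Pi^T = Pi) (Ups_sym : Ups^T = Ups).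

Let U (i j : 'I_14) := Pi1_upper gamma X Ai Bi Ci Qi Pi Ups
             sA sB sC sQ alpha beta rho i.+1 j.+1.

Let M := \mxblock_(p < 14, q < 14) (if (p <= q)%N then U p q else (U q p)^T).

Let U_diag i : (U i i)^T = U i i.
Proof.
case: i; do 14 ?[case=> [?|]]; rewrite /U /= ?tr_scalar_mx //.
by rewrite linearD /= trmxK addrC.
Qed.

Lemma tr_Pi1_blocks : M^T = M.
Proof. exact: tr_sym_mxblock. Qed.

(** The blocks of [x] have dimensions written with [Pi1_size]. The existential quantifiers retype
    them once and for all with the plain dimensions to which these compute, so that later algebra
    never meets [Pi1_size]. *)
Lemma Pi1_blocks_form (x : 'cV[R]_(\sum_(p < 14) Pi1_size n r N p.+1)) :
    exists (z1 : 'cV[R]_n) (z2 : 'cV[R]_r) (z3 : 'cV[R]_n) (z4 : 'cV[R]_r) (z5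
    : 'cV[R]_(\sum_(j < N) n)) (z6 : 'cV[R]_r) (z7 : 'cV[R]_n) (z8 : 'cV[R]_n)
    (z9 : 'cV[R]_n) (z10 : 'cV[R]_r) (z11 : 'cV[R]_r) (z12 : 'cV[R]_(\sum_(j <
    N) n)) (z13 : 'cV[R]_n) (z14 : 'cV[R]_r),
  dotv x x = dotv z1 z1 + dotv z2 z2 + dotv z3 z3 + dotv z4 z4 + dotv z5 z5
    + dotv z6 z6 + dotv z7 z7 + dotv z8 z8 + dotv z9 z9 + dotv z10 z10
    + dotv z11 z11 + dotv z12 z12 + dotv z13 z13 + dotv z14 z14 /\
  dotv x (M *m x) =
    dotv z1 ((X + X^T) *m z1) + dotv z2 z2 + dotv z3 (Pi *m z3)
    + gamma * dotv z4 z4 + dotv z5 (Ups *m z5) + 2 * alpha * dotv z6 z6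
    + 2 * alpha * dotv z7 z7 + alpha * dotv z8 z8 + beta * dotv z9 z9
    + beta * dotv z10 z10 + beta * dotv z11 z11 + rho * dotv z12 z12
    + rho * dotv z13 z13 + rho * dotv z14 z14
    + 2 * (dotv z1 (X *m Ai *m z3) + dotv z1 (X *m Bi *m z4)
           + dotv z1 (Qi *m Ups *m z5) + 2 * sA * dotv z1 (X *m z7)
           + sB * dotv z1 (X *m z9) + rho * dotv z1 z13
           + dotv z2 (Ci *m z3) + 2 * sC * dotv z2 z6 + rho * dotv z2 z14
           + alpha * dotv z3 z8 + beta * dotv z4 z11
           + sQ * dotv z5 (Ups *m z12)).
Proof.
exists (submxcol x (o 0)).
exists (submxcol x (o 1)).
exists (submxcol x (o 2)).
exists (submxcol x (o 3)).
exists (submxcol x (o 4)).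
exists (submxcol x (o 5)).
exists (submxcol x (o 6)).
exists (submxcol x (o 7)).
exists (submxcol x (o 8)).
exists (submxcol x (o 9)).
exists (submxcol x (o 10)).
exists (submxcol x (o 11)).
exists (submxcol x (o 12)).
exists (submxcol x (o 13)).
split; first by rewrite dotv_submxcol big_ord14 !addrA.
rewrite dotv_sym_mxblock //; under eq_bigr => i _ do rewrite big_mkcond.
rewrite !big_ord14; cbv beta; rewrite /U /=.
rewrite !mul0mx !dotv0r !mul_scalar_mx -!scalemxAl !dotvZr; lra.
Qed.

End Pi1Form.

(** One copy of [S] in [S + S^T] completes the square in [u], the other belongs to the form bounded
    below through [eta]. The remaining cross terms are absorbed by weighted squares. Those with
    coefficient [delta] cost [2 * delta] on each of [z1], ..., [z4]. Those with a grid bound cost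
    [s ^+ 2 / delta] times 4 on [z2], [6 * M] on [z1] through [S *m z1], and [2 * M] on [z5], that
    is [4 * M] more on [z1] and [4 * M] on [u]; hence the constant [4 + 10 * M]. *)
Lemma Pi1_blocks_posdef (R : realType) (gamma : R) (n r N : nat)
    (A : 'M[R]_n) (B : 'M[R]_(n, r)) (C : 'M[R]_(r, n))
    (Q : 'M[R]_(n, \sum_(j < N) n)) (P S : 'M[R]_n)
    (Ups : 'M[R]_(\sum_(j < N) n)) (s delta eta lam M : R)
    (U := Pi1_upper gamma S A B C Q P Ups s s s s delta delta delta) :
  P^T = P -> Ups^T = Ups -> S = Q *m Ups *m Q^T ->
  (forall y, dotv (Q^T *m y) (Q^T *m y) = dotv y y) ->
  (forall y, dotv (S *m y) (S *m y) <= M * dotv y y) ->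
  (forall y, dotv (Ups *m y) (Ups *m y) <= M * dotv y y) ->
  (forall y, lam * dotv y y <= dotv y (Ups *m y)) ->
  (forall z1 z2 z3 z4,
    eta * (dotv z1 z1 + dotv z2 z2 + dotv z3 z3 + dotv z4 z4) <=
    dotv z1 (S *m z1) + dotv z2 z2 + dotv z3 (P *m z3) + gamma * dotv z4 z4
    + 2 * (dotv z1 (S *m (A *m z3 + B *m z4)) + dotv z2 (C *m z3))) ->
  0 <= M -> 0 < eta -> 0 < lam -> 0 < delta -> 0 <= s ->
  8 * delta <= eta ->
  4 * (s ^+ 2 * (4 + 10 * M)) <= delta * eta ->
  2 * (s ^+ 2 * (4 + 10 * M)) <= delta * lam ->
  sym_posdef (\mxblock_(p < 14, q < 14)
    (if (p <= q)%N then U p.+1 q.+1 else (U q.+1 p.+1)^T)).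
Proof.
move=> P_sym Ups_sym SE Q_isom S_le Ups_le Ups_ge core_ge M_ge0 eta_gt0 lam_gt0.
move=> delta_gt0 s_ge0 delta_eta s_eta s_lam.
split=> [|x x0]; first exact: tr_Pi1_blocks.
have : 0 < dotv x x by rewrite lt0r dotvv_eq0 x0 dotvv_ge0.
rewrite dotv_form.
have [z1 [z2 [z3 [z4 [z5 [z6 [z7 [z8 [z9 [z10 [z11 [z12 [z13 [z14]]]]]]]]]]]]]] :=
  Pi1_blocks_form gamma S A B C Q s s s s delta delta delta P_sym Ups_sym x.
rewrite -/U => -[-> ->].
have S_sym : S^T = S by rewrite SE !trmx_mul trmxK Ups_sym mulmxA.
pose u := Q^T *m z1 + z5.
have T1 : dotv z1 (S *m z1) + 2 * dotv z1 (Q *m Ups *m z5) + dotv z5 (Ups *m z5)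
    = dotv u (Ups *m u).
  have QE w : dotv z1 (Q *m Ups *m w) = dotv (Q^T *m z1) (Ups *m w).
    by rewrite -mulmxA dotv_mulmx.
  have QU : dotv z5 (Ups *m (Q^T *m z1)) = dotv (Q^T *m z1) (Ups *m z5).
    by rewrite dotv_mulmx Ups_sym dotvC.
  rewrite /u SE -[Q *m Ups *m Q^T *m z1]mulmxA !QE.
  rewrite mulmxDr !dotvDl !dotvDr QU; ring.
(* The square in [u] has used up the diagonal term of [z5], so [z5] is controlled through [u] and
   [z1]; here [Q^T] preserves length. *)
have z5_le : dotv z5 z5 <= 2 * dotv z1 z1 + 2 * dotv u u.
  have -> : z5 = u - Q^T *m z1 by rewrite /u addrC addKr.
  have := dotvv_ge0 (u + Q^T *m z1); rewrite -scaleN1r.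
  rewrite !(dotvDl, dotvDr, dotvZl, dotvZr) !Q_isom; lra.
have T0 := core_ge z1 z2 z3 z4.
have T2 := Ups_ge u.
have SU := S_le z1; have UU := Ups_le z5.
rewrite mulmxDr dotvDr !mulmxA in T0.
rewrite mulmxDl dotvDr S_sym.
rewrite (dotv_mulmx S z1 z7) (dotv_mulmx S z1 z9) (dotv_mulmx Ups z5 z12) S_sym Ups_sym.
have sqr_ge0 m (c e : R) (v w : 'cV[R]_m) :
  0 <= c ^+ 2 * dotv v v + 2 * c * e * dotv v w + e ^+ 2 * dotv w w.
  have := dotvv_ge0 (c *: v + e *: w).
  rewrite !(dotvDl, dotvDr, dotvZl, dotvZr) (dotvC w v); lra.
have F1 := sqr_ge0 _ (2 * s) delta (S *m z1) z7.
have F2 := sqr_ge0 _ (2 * s) delta (S *m z1) z9.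
have F3 := sqr_ge0 _ (2 * s) delta z2 z6.
have F4 := sqr_ge0 _ (2 * s) delta (Ups *m z5) z12.
have F5 := sqr_ge0 _ 2 1 z3 z8.
have F6 := sqr_ge0 _ 2 1 z4 z11.
have F7 := sqr_ge0 _ 2 1 z1 z13.
have F8 := sqr_ge0 _ 2 1 z2 z14.
set F := (X in _ -> 0 < X).
(* Multiplying by [delta] turns the costs [s ^+ 2 / delta] into polynomials. Half of [eta] and of
   [lam] survives the absorption, and at least half of [delta] on each multiplier block. *)
have main : delta * (eta / 2 * (dotv z1 z1 + dotv z2 z2 + dotv z3 z3 + dotv z4 z4)
   + lam / 2 * dotv u u + delta / 2 * (dotv z6 z6 + dotv z7 z7 + dotv z8 z8
   + dotv z9 z9 + dotv z10 z10 + dotv z11 z11 + dotv z12 z12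
   + dotv z13 z13 + dotv z14 z14)) <= delta * F.
  have ss : 0 <= s ^+ 2 by rewrite exprn_ge0.
  have dd : 0 <= delta ^+ 2 by rewrite exprn_ge0 // ltW.
  have ssM : 0 <= s ^+ 2 * M by rewrite mulr_ge0.
  have dde : 8 * delta ^+ 2 <= delta * eta.
    by rewrite expr2 mulrCA ler_pM2l.
  have sse : 16 * s ^+ 2 <= delta * eta - 40 * (s ^+ 2 * M).
    by lra.
  have sM1 := ler_wpM2r (dotvv_ge0 z1) s_eta.
  have ss2 := ler_wpM2r (dotvv_ge0 z2) s_eta.
  have sM2 := mulr_ge0 ssM (dotvv_ge0 z2).
  have ss1 := mulr_ge0 ss (dotvv_ge0 z1).
  have ssu := mulr_ge0 ss (dotvv_ge0 u).
  have sMu := mulr_ge0 ssM (dotvv_ge0 u).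
  have d1 := ler_wpM2r (dotvv_ge0 z1) dde.
  have d2 := ler_wpM2r (dotvv_ge0 z2) dde.
  have d3 := ler_wpM2r (dotvv_ge0 z3) dde.
  have d4 := ler_wpM2r (dotvv_ge0 z4) dde.
  have lu := ler_wpM2r (dotvv_ge0 u) s_lam.
  have G0 := ler_wpM2l (ltW delta_gt0) T0.
  have G2 := ler_wpM2l (ltW delta_gt0) T2.
  have H1 := ler_wpM2l ss SU.
  have H2 := ler_wpM2l ss UU.
  have H3 := ler_wpM2l ssM z5_le.
  have E5 := mulr_ge0 dd F5.
  have E6 := mulr_ge0 dd F6.
  have E7 := mulr_ge0 dd F7.
  have E8 := mulr_ge0 dd F8.
  have p6 := mulr_ge0 dd (dotvv_ge0 z6).
  have p7 := mulr_ge0 dd (dotvv_ge0 z7).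
  have p10 := mulr_ge0 dd (dotvv_ge0 z10).
  have p11 := mulr_ge0 dd (dotvv_ge0 z11).
  have T1d : delta * (dotv z1 (S *m z1) + 2 * dotv z1 (Q *m Ups *m z5)
     + dotv z5 (Ups *m z5)) = delta * dotv u (Ups *m u) by rewrite T1.
  have eta1 := mulr_ge0 (mulr_ge0 (ltW delta_gt0) (ltW eta_gt0)) (dotvv_ge0 z1).
  have eta2 := mulr_ge0 (mulr_ge0 (ltW delta_gt0) (ltW eta_gt0)) (dotvv_ge0 z2).
  have eta3 := mulr_ge0 (mulr_ge0 (ltW delta_gt0) (ltW eta_gt0)) (dotvv_ge0 z3).
  have eta4 := mulr_ge0 (mulr_ge0 (ltW delta_gt0) (ltW eta_gt0)) (dotvv_ge0 z4).
  have lamu := mulr_ge0 (mulr_ge0 (ltW delta_gt0) (ltW lam_gt0)) (dotvv_ge0 u).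
  rewrite /F; lra.
move=> xpos; rewrite -(pmulr_rgt0 _ delta_gt0); apply: lt_le_trans main.
rewrite pmulr_rgt0 //.
have [k [k0 k1 k2 k3]] : exists k,
    [/\ 0 < k, k <= eta / 2, k <= lam / 2 & k <= delta / 2].
  exists (Num.min (eta / 2) (Num.min (lam / 2) (delta / 2))).
  by rewrite !lt_min !divr_gt0 // !ge_min !lexx !orbT.
(* The factor [1 / 4] leaves room for [z5], which [z5_le] charges to [z1] and [u] with weight 2. *)
apply: (@lt_le_trans _ _ (k / 4 *
    (dotv z1 z1 + dotv z2 z2 + dotv z3 z3 + dotv z4 z4 + dotv z5 z5
    + dotv z6 z6 + dotv z7 z7 + dotv z8 z8 + dotv z9 z9 + dotv z10 z10
    + dotv z11 z11 + dotv z12 z12 + dotv z13 z13 + dotv z14 z14))).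
  by rewrite mulr_gt0 // divr_gt0.
have K1 : k * (dotv z1 z1 + dotv z2 z2 + dotv z3 z3 + dotv z4 z4) <=
    eta / 2 * (dotv z1 z1 + dotv z2 z2 + dotv z3 z3 + dotv z4 z4).
  by rewrite ler_wpM2r // !addr_ge0 ?dotvv_ge0.
have K2 : k * dotv u u <= lam / 2 * dotv u u by rewrite ler_wpM2r ?dotvv_ge0.
set rest := dotv z6 z6 + dotv z7 z7 + dotv z8 z8 + dotv z9 z9 + dotv z10 z10
  + dotv z11 z11 + dotv z12 z12 + dotv z13 z13 + dotv z14 z14.
have r0 : 0 <= rest by rewrite /rest !addr_ge0 ?dotvv_ge0.
have K3 : k * rest <= delta / 2 * rest by rewrite ler_wpM2r.
have K4 := ler_wpM2l (ltW k0) z5_le.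
have k0r := mulr_ge0 (ltW k0) r0.
have kz m (z : 'cV[R]_m) := mulr_ge0 (ltW k0) (dotvv_ge0 z).
have k1z := kz _ z1; have k2z := kz _ z2; have k3z := kz _ z3; have k4z := kz _ z4.
have ku := kz _ u.
move: K3 k0r; rewrite /rest; lra.
Qed.

(** * Coercive matrices and perturbation of the form of [Xi] *)

Lemma coercive_unitmx (R : realType) (n : nat) (c : R) (M : 'M[R]_n) : 0 < c ->
  (forall x, c * dotv x x <= dotv x (M *m x)) -> M \in unitmx.
Proof.
move=> c0 Mc; rewrite -unitmx_tr -row_free_unit -kermx_eq0.
apply/eqP/row_matrixP => i; rewrite row0.
have k0 : row i (kermx M^T) *m M^T = 0 by rewrite -row_mul mulmx_ker row0.
have Mx0 : M *m (row i (kermx M^T))^T = 0.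
  by rewrite -[LHS]trmxK trmx_mul trmxK k0 trmx0.
have := Mc (row i (kermx M^T))^T; rewrite Mx0 dotv0r pmulr_rle0 // => le0.
have : (row i (kermx M^T))^T == 0 by rewrite -dotvv_eq0 eq_le le0 dotvv_ge0.
by rewrite trmx_eq0 => /eqP.
Qed.

(** Expanding [|M x - c x|^2 >= 0] gives [|M x|^2 >= 2 c <x, M x> - c^2 |x|^2], with no division by
    [|x|]. *)
Lemma coercive_sqr_le (R : realType) (n : nat) (c : R) (M : 'M[R]_n) x : 0 <= c ->
  c * dotv x x <= dotv x (M *m x) ->
  c ^+ 2 * dotv x x <= dotv (M *m x) (M *m x).
Proof.
move=> c0 Mc.
have := dotvv_ge0 (M *m x - c *: x); rewrite -scaleN1r.
rewrite !(dotvDl, dotvDr, dotvZl, dotvZr) (dotvC (M *m x) x) => h.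
have := ler_wpM2l c0 Mc; lra.
Qed.

Lemma dotv_col_mx (R : realType) m n (u1 v1 : 'cV[R]_m) (u2 v2 : 'cV[R]_n) :
  dotv (col_mx u1 u2) (col_mx v1 v2) = dotv u1 v1 + dotv u2 v2.
Proof. by rewrite /dotv tr_col_mx mul_row_col mxE. Qed.

Section Core.
Context {R : realType}.
Variables (n r : nat).

(** Replacing [E] by [S] and [P0] by [P] costs at most [eps * (1 + 2 * K)], hence [eta], per squared
    norm. The form of [W] supplies [2 * eta]: directly on [z2], [z3], [z4], and on [z1] because
    [|E z1|^2 >= lam^2 |z1|^2]. *)
Lemma core_lower_bound (A : 'M[R]_n) (B : 'M[R]_(n, r)) (C : 'M[R]_(r, n))
    (E S P0 P : 'M[R]_n) (gamma xi eps lam K eta : R)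
    (W := block_mx (block_mx (invmx E) 0 0 1%:M) (block_mx A B C 0)
           (block_mx A^T C^T B^T 0) (block_mx P0 0 0 gamma%:M)) :
  sym_psd (W - xi%:M) -> S^T = S ->
  0 <= xi -> 0 <= eps -> 0 < lam -> 0 <= K ->
  (forall x, lam * dotv x x <= dotv x (E *m x)) ->
  (forall x y, `|dotv x ((S - E) *m y)| <= eps * (enorm x * enorm y)) ->
  spectral_norm (P0 - P) <= eps ->
  spectral_norm A <= K -> spectral_norm B <= K ->
  2 * eta <= xi -> 2 * eta <= xi * lam ^+ 2 -> eps * (1 + 2 * K) <= eta ->
  forall z1 z2 z3 z4,
    eta * (dotv z1 z1 + dotv z2 z2 + dotv z3 z3 + dotv z4 z4) <=
    dotv z1 (S *m z1) + dotv z2 z2 + dotv z3 (P *m z3) + gamma * dotv z4 z4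
    + 2 * (dotv z1 (S *m (A *m z3 + B *m z4)) + dotv z2 (C *m z3)).
Proof.
move=> [_ Wxi] S_sym xi0 eps0 lam0 K0 Elam SE_le PP_le AK BK eta_xi eta_lam eta_eps.
move=> z1 z2 z3 z4.
have EU : E \in unitmx := coercive_unitmx lam0 Elam.
pose y := A *m z3 + B *m z4.
(* Taking [E *m z1] as first component cancels the inverse block: the form of [W] becomes that of
   the conclusion, with [E] and [P0] instead of [S] and [P]. *)
have := Wxi (col_mx (col_mx (E *m z1) z2) (col_mx z3 z4)).
rewrite dotv_form mulmxBl mul_scalar_mx dotvBr dotvZr !dotv_col_mx subr_ge0.
have -> : W *m col_mx (col_mx (E *m z1) z2) (col_mx z3 z4) =
  col_mx (col_mx (z1 + y) (z2 + C *m z3))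
    (col_mx (A^T *m (E *m z1) + C^T *m z2 + P0 *m z3)
            (B^T *m (E *m z1) + gamma *: z4)).
  rewrite /W !mul_block_col !mul0mx !addr0 !add0r mul1mx !mulmxA mulVmx // mul1mx.
  by rewrite mul_scalar_mx !add_col_mx.
rewrite !dotv_col_mx !dotvDr dotvZr (dotv_mulmx A^T) (dotv_mulmx B^T) (dotv_mulmx C^T).
rewrite !trmxK => h1.
have {}h1 : xi * (dotv (E *m z1) (E *m z1) + dotv z2 z2 + dotv z3 z3 + dotv z4 z4) <=
   dotv z1 (E *m z1) + dotv z2 z2 + dotv z3 (P0 *m z3) + gamma * dotv z4 z4
   + 2 * (dotv (E *m z1) y + dotv z2 (C *m z3)).
  move: h1; rewrite /y !dotvDr !(dotvC _ (E *m z1)) (dotvC (C *m z3)).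
  lra.
have h2 := ler_wpM2l xi0 (coercive_sqr_le (ltW lam0) (Elam z1)).
have := SE_le z1 z1; rewrite mulmxBl dotvBr -!expr2 => /ler_normlP[e1 _].
have := SE_le y z1; rewrite mulmxBl dotvBr (dotvC y) (dotvC y) => /ler_normlP[e2 _].
have Sy : dotv z1 (S *m y) = dotv (S *m z1) y by rewrite dotv_mulmx S_sym.
have : `|dotv z3 ((P0 - P) *m z3)| <= eps * enorm z3 ^+ 2.
  apply: le_trans (dotv_le_enorm _ _) _.
  rewrite expr2 mulrCA ler_wpM2l ?enorm_ge0 //.
  by apply: le_trans (enorm_mulmx _ _) _; rewrite ler_wpM2r ?enorm_ge0.
rewrite mulmxBl dotvBr => /ler_normlP[_ e3].
have y_le : enorm y <= K * (enorm z3 + enorm z4).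
  apply: le_trans (_ : enorm (A *m z3) + enorm (B *m z4) <= _).
    rewrite -ler_sqr ?nnegrE ?addr_ge0 ?enorm_ge0 // sqr_enorm /y.
    rewrite !(dotvDl, dotvDr) (dotvC (B *m z4)) -!sqr_enorm.
    have := le_trans (ler_norm _) (dotv_le_enorm (A *m z3) (B *m z4)); lra.
  rewrite mulrDr lerD //; apply: le_trans (enorm_mulmx _ _) _;
    by rewrite ler_wpM2r ?enorm_ge0.
rewrite -/y Sy.
(* This is the doubled cross term of [S - E] with [y], split by [2 s t <= s^2 + t^2]; it is the
   source of [2 * K] in [eta_eps]. *)
have e4 : enorm y * enorm z1 * 2 <=
    K * (2 * enorm z1 ^+ 2 + enorm z3 ^+ 2 + enorm z4 ^+ 2).
  apply: le_trans (_ : K * (enorm z3 + enorm z4) * enorm z1 * 2 <= _).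
    by rewrite ler_wpM2r // ler_wpM2r ?enorm_ge0.
  rewrite -!mulrA ler_wpM2l //.
  have := sqr_ge0 (enorm z3 - enorm z1); have := sqr_ge0 (enorm z4 - enorm z1); lra.
have e5 := ler_wpM2l eps0 e4.
move: e1 e3 e5; rewrite !sqr_enorm => e1 e3 e5.
have f1 := ler_wpM2r (dotvv_ge0 z1) eta_eps.
have f3 := ler_wpM2r (dotvv_ge0 z3) eta_eps.
have f4 := ler_wpM2r (dotvv_ge0 z4) eta_eps.
have g1 := ler_wpM2r (dotvv_ge0 z1) eta_lam.
have g2 := ler_wpM2r (dotvv_ge0 z2) eta_xi.
have g3 := ler_wpM2r (dotvv_ge0 z3) eta_xi.
have g4 := ler_wpM2r (dotvv_ge0 z4) eta_xi.
have eK := mulr_ge0 eps0 K0.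
have k1 := mulr_ge0 eK (dotvv_ge0 z1).
have k3 := mulr_ge0 eK (dotvv_ge0 z3).
have k4 := mulr_ge0 eK (dotvv_ge0 z4).
have l4 := mulr_ge0 eps0 (dotvv_ge0 z4).
(* The sign of [eta] is not a hypothesis; it follows from [eta_eps]. *)
have l2 : 0 <= eta * dotv z2 z2.
  rewrite mulr_ge0 ?dotvv_ge0 //; apply: le_trans eta_eps.
  by rewrite mulr_ge0 // addr_ge0 // mulr_ge0.
lra.
Qed.

End Core.

(** * Rows of scalar blocks, block diagonals and convex combinations *)

Section ScalarRow.
Context {R : realType}.
Variables (n N : nat).

(** The shape of [Qmx] with free coefficients, so that it also covers the difference of two values
    of [Qmx]. *)
Definition scalar_row (d : 'I_N -> R) : 'M[R]_(n, \sum_(j < N) n) :=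
  \mxrow_(j < N) (d j)%:M.

Lemma tr_scalar_row_mul d (y : 'cV[R]_n) :
  (scalar_row d)^T *m y = \mxcol_(j < N) (d j *: y).
Proof.
rewrite tr_mxrow mxcol_mul; apply: eq_mxcol => j.
by rewrite tr_scalar_mx mul_scalar_mx.
Qed.

Lemma dotv_mxcol (u v : 'I_N -> 'cV[R]_n) :
  dotv (\mxcol_(j < N) u j) (\mxcol_(j < N) v j) = \sum_j dotv (u j) (v j).
Proof. by rewrite dotv_submxcol; apply: eq_bigr => j _; rewrite !mxcolK. Qed.

Lemma scalar_row_isom d (y : 'cV[R]_n) :
  dotv ((scalar_row d)^T *m y) ((scalar_row d)^T *m y) =
  (\sum_j d j ^+ 2) * dotv y y.
Proof.
rewrite tr_scalar_row_mul dotv_mxcol mulr_suml; apply: eq_bigr => j _.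
by rewrite dotvZl dotvZr mulrA expr2.
Qed.

(** The transpose multiplies every Euclidean norm by the square root of [\sum_j d j ^+ 2], and
    transposition preserves the spectral norm. *)
Lemma scalar_row_norm d (s : R) : 0 <= s -> \sum_j d j ^+ 2 <= s ^+ 2 ->
  spectral_norm (scalar_row d) <= s.
Proof.
move=> s0 ds; rewrite -spectral_norm_tr; apply: spectral_norm_le => // y.
rewrite -ler_sqr ?nnegrE ?mulr_ge0 ?enorm_ge0 // exprMn !sqr_enorm scalar_row_isom.
by rewrite ler_wpM2r ?dotvv_ge0.
Qed.

Variable P : 'I_N -> 'M[R]_n.
Let Ups := \mxdiag_(j < N) P j.

Lemma tr_mxdiag_sym : (forall j, (P j)^T = P j) -> Ups^T = Ups.
Proof. by move=> PT; rewrite tr_mxdiag; apply: eq_mxdiag. Qed.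

Lemma mxdiag_mul_submxcol (y : 'cV[R]_(\sum_(j < N) n)) :
  Ups *m y = \mxcol_(j < N) (P j *m submxcol y j).
Proof. by rewrite -{1}(submxcolK y) mul_mxdiag_mxcol. Qed.

Lemma scalar_row_mxdiag d :
  scalar_row d *m Ups *m (scalar_row d)^T = \sum_j d j ^+ 2 *: P j.
Proof.
rewrite mul_mxrow_mxdiag tr_mxrow mul_mxrow_mxcol; apply: eq_bigr => j _.
by rewrite tr_scalar_mx mul_scalar_mx mul_mx_scalar scalerA expr2.
Qed.

Lemma mxdiag_sqr_le (m : R) : (forall j, spectral_norm (P j) <= m) ->
  forall y, dotv (Ups *m y) (Ups *m y) <= m ^+ 2 * dotv y y.
Proof.
move=> Pm y; rewrite mxdiag_mul_submxcol dotv_mxcol dotv_submxcol mulr_sumr.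
apply: ler_sum => j _; rewrite -!sqr_enorm -exprMn.
rewrite ler_pXn2r ?nnegrE ?enorm_ge0 //; last first.
  by rewrite mulr_ge0 ?enorm_ge0 // (le_trans (spectral_norm_ge0 (P j))).
by apply: le_trans (enorm_mulmx _ _) _; rewrite ler_wpM2r ?enorm_ge0.
Qed.

Lemma mxdiag_coercive (lam : R) :
  (forall j x, lam * dotv x x <= dotv x (P j *m x)) ->
  forall y, lam * dotv y y <= dotv y (Ups *m y).
Proof.
move=> Pl y; rewrite mxdiag_mul_submxcol [dotv y (mxcol _)]dotv_submxcol.
rewrite dotv_submxcol mulr_sumr; apply: ler_sum => j _.
by rewrite mxcolK.
Qed.

Lemma convex_comb_coercive (q : 'I_N -> R) (lam : R) :
  (forall j, 0 <= q j) -> \sum_j q j = 1 ->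
  (forall j x, lam * dotv x x <= dotv x (P j *m x)) ->
  forall x, lam * dotv x x <= dotv x ((\sum_j q j *: P j) *m x).
Proof.
move=> q0 q1 Pl x; rewrite mulmx_suml dotv_sumr -[leLHS]mul1r -q1 mulr_suml.
by apply: ler_sum => j _; rewrite -scalemxAl dotvZr ler_wpM2l.
Qed.

(** Pairing [v = \sum_j q j *: P j *m x] with itself gives [|v|^2 <= |v| m |x|] term by term, and
    [|v|] cancels. *)
Lemma convex_comb_sqr_le (q : 'I_N -> R) (m : R) :
  (forall j, 0 <= q j) -> \sum_j q j = 1 -> 0 <= m ->
  (forall j, spectral_norm (P j) <= m) ->
  forall x, dotv ((\sum_j q j *: P j) *m x) ((\sum_j q j *: P j) *m x) <=
            m ^+ 2 * dotv x x.
Proof.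
move=> q0 q1 m0 Pm x; rewrite -!sqr_enorm -exprMn.
rewrite ler_pXn2r ?nnegrE ?mulr_ge0 ?enorm_ge0 //.
set v := _ *m x; have [->|v0] := eqVneq v 0; first by rewrite enorm0 mulr_ge0 ?enorm_ge0.
have vp : 0 < enorm v by rewrite lt0r enorm_eq0 v0 enorm_ge0.
rewrite -(ler_pM2l vp) -expr2 sqr_enorm {2}/v mulmx_suml dotv_sumr.
rewrite -[leRHS]mul1r -q1 mulr_suml; apply: ler_sum => j _.
rewrite -scalemxAl dotvZr ler_wpM2l //.
apply: le_trans (ler_norm _) _; apply: le_trans (dotv_le_enorm _ _) _.
rewrite ler_wpM2l ?enorm_ge0 //.
by apply: le_trans (enorm_mulmx _ _) _; rewrite ler_wpM2r ?enorm_ge0.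
Qed.

Lemma convex_comb_sym (q : 'I_N -> R) : (forall j, (P j)^T = P j) ->
  (\sum_j q j *: P j)^T = \sum_j q j *: P j.
Proof.
move=> PT; rewrite linear_sum /=; apply: eq_bigr => j _.
by rewrite linearZ /= PT.
Qed.

End ScalarRow.

(** * Almost-everywhere bounds and averages against a density *)

Section Measure.
Context {R : realType}.
Variables (a b : R) (mu : {measure set R -> \bar R}).

Lemma normHinf_le n m (M : R -> 'M[R]_(n, m)) (c : R) :
  (normHinf a b mu M <= c%:E)%E ->
  {ae mu, forall l, l \in `[a, b] -> spectral_norm (M l) <= c}.
Proof.
move/ess_supP => [S [mS S0 MS]].
(* [S] is null for the restricted measure, so its trace on [[a, b]] is null for [mu]. *)
exists (S `&` `[a, b]); split => //.
  exact: measurableI.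
move=> l /= /not_implyP[lab Ml]; split => //.
by apply: MS => /=; rewrite lee_fin.
Qed.

Lemma Hinf_bounded n m (M : R -> 'M[R]_(n, m)) : Hinf a b mu M ->
  exists2 c : R, 0 <= c &
    {ae mu, forall l, l \in `[a, b] -> spectral_norm (M l) <= c}.
Proof.
(* The maximum with 0 gives a nonnegative bound even when the essential supremum is [-oo], as on a
   null interval. *)
move=> [_ Moo]; exists (Num.max 0 (fine (normHinf a b mu M))).
  by rewrite le_max lexx.
apply: normHinf_le; move: Moo; case: (normHinf a b mu M) => [s _| |_] //=.
  by rewrite lee_fin le_max lexx orbT.
by rewrite leNye.
Qed.

Hypothesis mu_lebesgue : forall S : set R, measurable S -> S `<=` `[a, b] ->
  mu S = lebesgue_measure S.

(** Otherwise an interval of positive length would lie inside a null set. The half-open form fits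
    inside a cell whether or not it is the last one. *)
Lemma ae_itv_exists (G : R -> Prop) (x y : R) : a <= x -> y <= b -> x < y ->
  {ae mu, forall l, l \in `[a, b] -> G l} ->
  exists2 l, l \in `[x, y[ & G l.
Proof.
move=> ax yb xy [S [mS S0 GS]].
apply: contrapT => nG.
have sub : `[x, y[ `<=` `[a, b].
  move=> t /=; rewrite !in_itv /= => /andP[xt ty].
  by rewrite (le_trans ax) // (le_trans (ltW ty)).
have xyS : `[x, y[ `<=` S.
  move=> t txy; apply: GS => /= /(_ (sub _ txy)) Gt; apply: nG; by exists t.
have : (mu `[x, y[%classic <= mu S)%E by apply: le_measure => //; rewrite inE.
rewrite S0 mu_lebesgue // lebesgue_measure_itv /= lte_fin xy.
by rewrite -EFinB lee_fin leNgt subr_gt0 xy.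
Qed.

Lemma Rintegral_sum (D : set R) (I : Type) (s : seq I) (F : I -> R -> R) :
  measurable D -> (forall i, mu.-integrable D (EFin \o F i)) ->
  \int[mu]_(t in D) (\sum_(i <- s) F i t) = \sum_(i <- s) \int[mu]_(t in D) F i t.
Proof.
move=> mD iF; elim: s => [|i s IH].
  by rewrite big_nil; under eq_Rintegral do rewrite big_nil; rewrite Rintegral_cst ?mul0r.
rewrite big_cons -IH -RintegralD //; last first.
  have := @integrable_sum _ _ _ mu D mD _ s xpredT
    (fun i => EFin \o F i) (fun i _ => iF i).
  apply: eq_integrable => // t _; by rewrite /= -sumEFin.
by apply: eq_Rintegral => t _; rewrite big_cons.
Qed.

Lemma density_integrable (p : R -> R) : probability_density a b mu p ->
  mu.-integrable `[a, b] (EFin \o p).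
Proof.
move=> [mp p0 p1]; apply/integrableP; split; first exact/measurable_EFinP.
rewrite (eq_integral (EFin \o p)) ?p1 ?ltry // => t; rewrite inE => tab /=.
by rewrite ger0_norm ?p0.
Qed.

(** The weight [p] has mass 1. This bound yields both the integrability of [p * f] and the estimate
    of its average. *)
Lemma density_abs_integral (p f : R -> R) (c : R) :
  probability_density a b mu p -> measurable_fun `[a, b] f -> 0 <= c ->
  {ae mu, forall t, t \in `[a, b] -> `|f t| <= c} ->
  (\int[mu]_(t in `[a, b]) `|(p t * f t)%:E| <= c%:E)%E.
Proof.
move=> pd mf c0 fc; have [mp p0 p1] := pd.
have mpf : measurable_fun `[a, b] (EFin \o (fun t => p t * f t)).
  by apply/measurable_EFinP; exact: measurable_funM.
rewrite -[leRHS]mule1 -p1 -ge0_integralZl //; first last.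
- exact/measurable_EFinP.
apply: ae_ge0_le_integral => //.
- by apply: measurableT_comp.
- by move=> t tab; rewrite mule_ge0 // lee_fin ?p0.
- by apply: measurable_funeM; exact/measurable_EFinP.
apply: filterS fc => t fc tab; rewrite -EFinM lee_fin normrM mulrC.
by rewrite (ger0_norm (p0 _ tab)) ler_wpM2r ?p0 ?fc.
Qed.

Lemma density_mul_integrable (p f : R -> R) (c : R) :
  probability_density a b mu p -> measurable_fun `[a, b] f -> 0 <= c ->
  {ae mu, forall t, t \in `[a, b] -> `|f t| <= c} ->
  mu.-integrable `[a, b] (EFin \o (fun t => p t * f t)).
Proof.
move=> pd mf c0 fc; have [mp p0 p1] := pd; apply/integrableP; split.
  by apply/measurable_EFinP; exact: measurable_funM.
exact: le_lt_trans (density_abs_integral pd mf c0 fc) (ltry _).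
Qed.

Lemma density_mul_Rintegral_le (p f : R -> R) (c : R) :
  probability_density a b mu p -> measurable_fun `[a, b] f -> 0 <= c ->
  {ae mu, forall t, t \in `[a, b] -> `|f t| <= c} ->
  `|\int[mu]_(t in `[a, b]) (p t * f t)| <= c.
Proof.
move=> pd mf c0 fc; have I := density_mul_integrable pd mf c0 fc.
rewrite -lee_fin EFin_normr_Rintegral //.
apply: le_trans (density_abs_integral pd mf c0 fc).
by apply: le_abse_integral => //; case/integrableP: I.
Qed.

End Measure.

(** * Cells of a partition *)

Section Cells.
Context {R : realType}.
Variables (a b : R) (N : nat) (h : nat -> R).
Hypothesis part : is_partition a b N h.

Lemma partition_le i j : (i <= j)%N -> (j <= N)%N -> h i <= h j.
Proof.
have [_ _ hlt] := part.
elim: j => [|j IH]; first by rewrite leqn0 => /eqP ->.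
rewrite leq_eqVlt => /predU1P[->//|]; rewrite ltnS => ij jN.
by apply: le_trans (IH ij (ltnW jN)) _; apply/ltW/hlt.
Qed.

Lemma cell_sub (i : 'I_N) : cell h i `<=` `[a, b].
Proof.
have [<- <- _] := part.
move=> t ct; have /andP[h1 h2] : h i <= t <= h i.+1.
  move: ct; rewrite /cell; case: ifP => _ /=; rewrite in_itv //=.
  by move=> /andP[-> /ltW].
rewrite /= in_itv /= (le_trans _ h1) ?(le_trans h2) //; apply: partition_le => //.
exact: ltnW.
Qed.

Lemma itv_sub_cell (i : 'I_N) : `[h i, h i.+1[ `<=` cell h i.
Proof.
move=> t; rewrite /cell; case: ifP => _ //=; rewrite !in_itv /=.
by move=> /andP[-> /ltW].
Qed.

Lemma cell_bounds (i : 'I_N) t : cell h i t -> h i <= t <= h i.+1.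
Proof.
rewrite /cell; case: ifP => _ /=; rewrite in_itv //=.
by move=> /andP[-> /ltW].
Qed.

Lemma measurable_cell (i : 'I_N) : measurable (cell h i).
Proof. exact: measurable_itv. Qed.

(** Only the last cell is closed: induction treats the half-open intervals [[a, h i[], and the
    closed cell is attached at the end. *)
Lemma Rintegral_cells (mu : {measure set R -> \bar R}) (f : R -> R) : (0 < N)%N ->
  mu.-integrable `[a, b] (EFin \o f) ->
  \int[mu]_(t in `[a, b]) f t = \sum_(i < N) \int[mu]_(t in cell h i) f t.
Proof.
move: part partition_le; case: N => // m [ha hb hlt] hle _ fi.
have sub i : (i <= m)%N -> `[a, h i[ `<=` `[a, b].
  move=> im t /=; rewrite !in_itv /= => /andP[-> /= ti].
  by rewrite (le_trans (ltW ti)) // -hb; apply: hle => //; apply: leqW.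
have I i : (i <= m)%N ->
    \int[mu]_(t in `[a, h i[) f t = \sum_(k < i) \int[mu]_(t in `[h k, h k.+1[) f t.
  elim: i => [_|i IH im].
    by rewrite big_ord0 ha set_itvco0 Rintegral_set0.
  rewrite big_ord_recr /= -IH ?(ltnW im) // -Rintegral_setU //.
  - rewrite -itv_bndbnd_setU // bnd_simp -?ha ?hle // ?leqW ?(ltnW im) //.
  - rewrite -itv_bndbnd_setU ?bnd_simp -?ha ?hle // ?leqW ?(ltnW im) //.
    by apply: integrableS fi => //; rewrite ha; exact: sub.
  - apply/disj_setPS => t /= []; rewrite !in_itv /= => /andP[_ ti] /andP[it _].
    by move: (lt_le_trans ti it); rewrite ltxx.
rewrite big_ord_recr /=.
have -> : cell h (@ord_max m) = `[h m, b]%classic by rewrite /cell /= eqxx hb.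
have -> : \sum_(i < m) \int[mu]_(t in cell h (widen_ord (leqnSn m) i)) f t =
          \sum_(i < m) \int[mu]_(t in `[h i, h i.+1[) f t.
  by apply: eq_bigr => i _; rewrite /cell /= eqSS ltn_eqF.
have E : `[a, b]%classic = `[a, h m[ `|` `[h m, b].
  by rewrite -itv_bndbnd_setU ?bnd_simp // -?ha -?hb; apply: hle.
rewrite -I // E Rintegral_setU -?E //.
apply/disj_setPS => t /= []; rewrite !in_itv /= => /andP[_ ti] /andP[it _].
by move: (lt_le_trans ti it); rewrite ltxx.
Qed.

End Cells.

(** * Averages of matrix functions against the kernel density *)

Lemma dotv_mulmxE (R : realType) n m (M : 'M[R]_(n, m)) u v :
  dotv u (M *m v) = \sum_(p : 'I_n * 'I_m) u p.1 0 * v p.2 0 * M p.1 p.2.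
Proof.
rewrite dotvE -(pair_bigA _ (fun i j => u i 0 * v j 0 * M i j)) /=.
apply: eq_bigr => i _; rewrite mxE mulr_sumr; apply: eq_bigr => j _.
by rewrite (mulrC (M i j)) mulrA.
Qed.

Section Averages.
Context {R : realType}.
Variables (a b : R) (mu : {measure set R -> \bar R}) (g : R -> R -> R) (l : R).
Hypothesis gl_density : probability_density a b mu (g l).
Variable n : nat.

Definition entrywise_measurable (M : R -> 'M[R]_n) :=
  forall i j, measurable_fun `[a, b] (fun t => M t i j).

Definition ae_bounded (M : R -> 'M[R]_n) (c : R) :=
  {ae mu, forall t, t \in `[a, b] -> spectral_norm (M t) <= c}.

Lemma entry_integrable (M : R -> 'M[R]_n) c i j : entrywise_measurable M ->
  0 <= c -> ae_bounded M c ->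
  mu.-integrable `[a, b] (EFin \o (fun t => g l t * M t i j)).
Proof.
move=> mM c0 Mc; apply: (density_mul_integrable gl_density (mM i j) c0).
apply: filterS Mc => t Mc /Mc; apply: le_trans; exact: norm_entry_le.
Qed.

Lemma dotv_Eop (M : R -> 'M[R]_n) c u v : entrywise_measurable M ->
  0 <= c -> ae_bounded M c ->
  dotv u (Eop a b mu g M l *m v) =
  \int[mu]_(t in `[a, b]) (g l t * dotv u (M t *m v)).
Proof.
move=> mM c0 Mc; rewrite dotv_mulmxE.
have iM := entry_integrable _ _ mM c0 Mc.
transitivity (\sum_(p : 'I_n * 'I_n)
    \int[mu]_(t in `[a, b]) (u p.1 0 * v p.2 0 * (g l t * M t p.1 p.2))).
  by apply: eq_bigr => p _; rewrite mxE RintegralZl.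
rewrite -Rintegral_sum //; last first.
  move=> p; exact: (integrableZl _ (u p.1 0 * v p.2 0) (iM p.1 p.2)).
apply: eq_Rintegral => t _; rewrite dotv_mulmxE mulr_sumr.
by apply: eq_bigr => p _; rewrite mulrCA.
Qed.

(** Working with bilinear forms keeps the constant [c]; a bound on [Eop] entry by entry would lose a
    factor depending on [n]. *)
Lemma dotv_Eop_le (M : R -> 'M[R]_n) c u v : entrywise_measurable M ->
  0 <= c -> ae_bounded M c ->
  `|dotv u (Eop a b mu g M l *m v)| <= c * (enorm u * enorm v).
Proof.
move=> mM c0 Mc; rewrite (dotv_Eop _ _ mM c0 Mc).
apply: density_mul_Rintegral_le => //.
- have -> : (fun t => dotv u (M t *m v)) =
      (fun t => \sum_(p : 'I_n * 'I_n) u p.1 0 * v p.2 0 * M t p.1 p.2).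
    by apply/funext => t; rewrite dotv_mulmxE.
  apply: measurable_sum => p; apply: measurable_funM => //; exact: mM.
- by rewrite !mulr_ge0 ?enorm_ge0.
apply: filterS Mc => t Mc /Mc {}Mc; apply: le_trans (dotv_le_enorm _ _) _.
rewrite mulrCA ler_wpM2l ?enorm_ge0 //.
by apply: le_trans (enorm_mulmx _ _) _; rewrite ler_wpM2r ?enorm_ge0.
Qed.

Lemma EopB (M1 M2 : R -> 'M[R]_n) c1 c2 :
  entrywise_measurable M1 -> entrywise_measurable M2 ->
  0 <= c1 -> 0 <= c2 -> ae_bounded M1 c1 -> ae_bounded M2 c2 ->
  Eop a b mu g (fun t => M1 t - M2 t) l = Eop a b mu g M1 l - Eop a b mu g M2 l.
Proof.
move=> m1 m2 c10 c20 M1c M2c; apply/matrixP => i j; rewrite !mxE.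
rewrite -RintegralB //; first last.
- exact: (entry_integrable _ _ m2 c20 M2c).
- exact: (entry_integrable _ _ m1 c10 M1c).
by apply: eq_Rintegral => t _; rewrite !mxE mulrBr.
Qed.

Variables (N : nat) (h : nat -> R).
Hypotheses (part : is_partition a b N h) (N0 : (0 < N)%N).

Lemma cell_prob_ge0 (j : 'I_N) : 0 <= cell_prob mu g h j l.
Proof.
have [_ g0 _] := gl_density.
by apply: Rintegral_ge0 => t /(cell_sub part); apply: g0.
Qed.

Lemma sum_cell_prob : \sum_(j < N) cell_prob mu g h j l = 1.
Proof.
rewrite -(Rintegral_cells part N0 (density_integrable gl_density)).
by have [_ _ g1] := gl_density; rewrite /Rintegral g1.
Qed.

Lemma Eop_piecewise (M : R -> 'M[R]_n) c (P : 'I_N -> 'M[R]_n) :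
  entrywise_measurable M -> 0 <= c -> ae_bounded M c ->
  (forall i t, cell h i t -> M t = P i) ->
  Eop a b mu g M l = \sum_(j < N) cell_prob mu g h j l *: P j.
Proof.
move=> mM c0 Mc MP; apply/matrixP => i j; rewrite mxE summxE.
rewrite (Rintegral_cells part N0 (entry_integrable _ _ mM c0 Mc)).
apply: eq_bigr => k _; rewrite mxE /cell_prob -RintegralZr //.
- by apply: eq_Rintegral => t; rewrite inE => tk; rewrite (MP k).
- exact: measurable_cell.
apply: integrableS (density_integrable gl_density) => //.
  exact: measurable_cell.
exact: (cell_sub part).
Qed.

End Averages.

(** For [s >= t >= 0], [(s - t)^2 <= (s - t) (s + t) = s^2 - t^2]. *)
Lemma sqr_sqrtB_le (R : realType) (x y : R) : 0 <= x -> 0 <= y ->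
  (Num.sqrt x - Num.sqrt y) ^+ 2 <= `|x - y|.
Proof.
wlog xy : x y / y <= x => [hw|x0 y0].
  have [/hw|/ltW/hw h x0 y0] := leP y x; first exact.
  by rewrite -sqrrN opprB distrC h.
rewrite ger0_norm ?subr_ge0 // -{2}(sqr_sqrtr x0) -{2}(sqr_sqrtr y0).
have := ler_wsqrtr xy; have := sqrtr_ge0 y; move: (Num.sqrt x) (Num.sqrt y) => s t t0 ts.
have := mulr_ge0 t0 (_ : 0 <= s - t); rewrite subr_ge0 => /(_ ts); lra.
Qed.

(** The bound does not depend on the number of cells. Since [Qmx] itself depends on the grid, this
    is what allows the mesh to be fixed from [g] alone before the grid is refined. *)
Lemma sum_sqrt_cell_prob_le (R : realType) (a b : R) (mu : {measure set R -> \bar R})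
    (g : R -> R -> R) (N : nat) (h : nat -> R) (l l' w : R) :
  is_partition a b N h -> (0 < N)%N -> mu `[a, b]%classic = (b - a)%:E ->
  probability_density a b mu (g l) -> probability_density a b mu (g l') ->
  (forall t, t \in `[a, b] -> `|g l t - g l' t| <= w) ->
  \sum_(j < N) (Num.sqrt (cell_prob mu g h j l) -
                Num.sqrt (cell_prob mu g h j l')) ^+ 2 <= w * (b - a).
Proof.
move=> part N0 muab gl gl' gw.
have il := density_integrable gl; have il' := density_integrable gl'.
have iB : mu.-integrable `[a, b] (EFin \o (fun t => g l t - g l' t)).
  exact: (integrableB _ il il').
have cS (j : 'I_N) f : mu.-integrable `[a, b] (EFin \o f) ->
    mu.-integrable (cell h j) (EFin \o f).
  move=> fi; apply: integrableS fi => //; first exact: measurable_cell.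
  exact: (cell_sub part).
apply: le_trans (_ : \sum_(j < N) \int[mu]_(t in cell h j) `|g l t - g l' t| <= _).
  apply: ler_sum => j _; apply: le_trans (sqr_sqrtB_le _ _) _.
  - exact: cell_prob_ge0 gl _ _ part _.
  - exact: cell_prob_ge0 gl' _ _ part _.
  rewrite /cell_prob -RintegralB //; try exact: measurable_cell; try exact: cS.
  by apply: le_normr_Rintegral; [exact: measurable_cell|exact: cS].
rewrite -(Rintegral_cells part N0 (f := fun t => `|g l t - g l' t|)); last first.
  exact: integrable_norm.
rewrite -[b - a]/(fine (b - a)%:E) -muab -Rintegral_cst //.
apply: le_Rintegral => //; first exact: integrable_norm.
apply/integrableP; split; first exact: measurable_cst.
by rewrite integral_cst //= muab -EFinM ltry.
Qed.

(** * Refinement of the grid *)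

(** Heine-Cantor, through the near-covering form of compactness applied to the filter of small
    positive radii. *)
Lemma compact_unif_continuous (R : realType) (T V : pseudoMetricType R)
    (K : set T) (f : T -> V) (e : R) :
  compact K -> {within K, continuous f} -> 0 < e ->
  exists2 d : R, 0 < d &
    forall x y, K x -> K y -> ball x d y -> ball (f x) e (f y).
Proof.
move=> /compact_near_coveringP/near_covering_withinP cK.
move=> /subspace_continuousP cf e0.
have := cK _ (0%R^'+ : set_system R)
  (fun d x => forall y, K y -> ball x d y -> ball (f x) e (f y)) _.
move=> /(_ _)[].
- move=> x Kx; have e20 : 0 < e / 2 by rewrite divr_gt0.
  have := cf x Kx (ball (f x) (e / 2)) (nbhsx_ballx _ _ e20).
  rewrite /= nbhs_simpl /within /= => /nbhs_ballP[s /= s0 fs].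
  have s20 : 0 < s / 2 by rewrite divr_gt0.
  (* A point within [s / 2] of [x] and a second one within [d < s / 2] of the first both lie in the
     ball of radius [s] on which [f] stays within [e / 2] of [f x]. *)
  exists (ball x (s / 2), [set d : R | d < s / 2]).
    split => /=; first exact: nbhsx_ballx.
    exact: nbhs_right_lt.
  move=> [x' d] /= [xx' ds] Kx' y Ky x'y.
  apply: (@ball_splitr _ _ (f x)).
    by apply: fs Kx'; apply: le_ball xx'; rewrite ler_pdivrMr // ler_pMr // ler1n.
  apply: fs Ky; rewrite [s]splitr; apply: ball_triangle xx' _.
  by apply: le_ball x'y; exact: ltW.
move=> d /= d0 Kd; exists (d / 2); first by rewrite divr_gt0.
move=> x y Kx Ky; apply: (Kd (d / 2)) => //=; last by rewrite divr_gt0.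
by rewrite sub0r normrN gtr0_norm ?divr_gt0 // ltr_pdivrMr // ltr_pMr // ltr1n.
Qed.

Lemma mx_unif_continuous (R : realType) (a b : R) n m (M : R -> 'M[R]_(n, m)) (e : R) :
  {within `[a, b], continuous M} -> 0 < e ->
  exists2 d : R, 0 < d & forall l l', l \in `[a, b] -> l' \in `[a, b] ->
    `|l - l'| < d -> spectral_norm (M l - M l') <= e.
Proof.
(* There are [n * m] entries, each allotted [e / c]; the successor keeps [c] positive for empty
   matrices. *)
move=> cM e0; pose c : R := (n * m).+1%:R.
have [|d d0 Md] := compact_unif_continuous (e := e / c) (@segment_compact R a b) cM.
  by rewrite divr_gt0.
exists d => // l l' lab l'ab ll'.
have [_ /= Mll'] := Md l l' lab l'ab ll'.
apply: le_trans (spectral_norm_le_sum _) _.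
apply: (@le_trans _ _ (\sum_(i < n) \sum_(j < m) e / c)).
  by apply: ler_sum => i _; apply: ler_sum => j _; rewrite !mxE; apply/ltW/Mll'.
rewrite !sumr_const !card_ord -mulrnA -mulr_natr mulrAC ler_pdivrMr //.
by rewrite ler_pM2l // /c ler_nat mulnC.
Qed.

Section Refinement.
Context {R : realType}.
Variables (a b : R) (N : nat) (h : nat -> R) (K : nat).
Hypotheses (part : is_partition a b N h) (K0 : (0 < K)%N).

(** Cuts each interval of [h] into [K] equal pieces. At [m = N * K] the remainder is 0, so the
    meaningless value [h N.+1] is multiplied by 0. *)
Definition refine m : R := h (m %/ K)%N
  + (h (m %/ K).+1 - h (m %/ K)%N) * ((m %% K)%N%:R / K%:R).

(** Node [m.+1] is read from the interval containing node [m]: when the remainder reaches [K], the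
    formula gives the right end, which is the start of the next interval. *)
Let refineS m : refine m.+1 =
  h (m %/ K)%N + (h (m %/ K).+1 - h (m %/ K)%N) * ((m %% K).+1%:R / K%:R).
Proof.
have Kn0 : K%:R != 0 :> R by rewrite pnatr_eq0 -lt0n.
have mE : m.+1 = (m %/ K * K + (m %% K).+1)%N by rewrite addnS -divn_eq.
have := ltn_pmod m K0; rewrite leq_eqVlt => /predU1P[rK|rK].
  have dE : (m.+1 %/ K = (m %/ K).+1)%N by rewrite {1}mE rK divnMDl // divnn K0 addn1.
  have rE : (m.+1 %% K = 0)%N by rewrite {1}mE rK modnMDl modnn.
  by rewrite {1}/refine dE rE rK mul0r mulr0 addr0 divff // mulr1 addrC subrK.
have dE : (m.+1 %/ K = m %/ K)%N by rewrite {1}mE divnMDl // (divn_small rK) addn0.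
have rE : (m.+1 %% K = (m %% K).+1)%N by rewrite {1}mE modnMDl modn_small.
by rewrite {1}/refine dE rE.
Qed.

Let stepE m : refine m.+1 - refine m =
  (h (m %/ K).+1 - h (m %/ K)%N) / K%:R.
Proof. by rewrite refineS /refine -natr1; ring. Qed.

Let parent_lt m : (m < N * K)%N -> (m %/ K < N)%N.
Proof. by rewrite ltn_divLR. Qed.

Lemma refine_partition : is_partition a b (N * K) refine.
Proof.
have [ha hb hlt] := part; split.
- by rewrite /refine div0n mod0n mul0r mulr0 addr0.
- by rewrite /refine mulnK // modnMl mul0r mulr0 addr0.
move=> m mNK; rewrite -subr_gt0 stepE divr_gt0 ?ltr0n // subr_gt0.
exact/hlt/parent_lt.
Qed.

Definition parent (i : 'I_(N * K)) : 'I_N := Ordinal (parent_lt (ltn_ord i)).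

Lemma cell_refine_sub (i : 'I_(N * K)) t : cell refine i t -> cell h (parent i) t.
Proof.
have [ha hb hlt] := part; move=> ct.
have /andP[t1 t2] := cell_bounds ct.
have hq : 0 < h (i %/ K).+1 - h (i %/ K)%N.
  by rewrite subr_gt0; exact/hlt/parent_lt.
have l1 : h (i %/ K)%N <= t.
  by apply: le_trans t1; rewrite /refine lerDl mulr_ge0 ?divr_ge0 // ltW.
have l2 : refine i.+1 <= h (i %/ K).+1.
  rewrite refineS -lerBrDl ler_piMr ?(ltW hq) //.
  by rewrite ler_pdivrMr ?ltr0n // mul1r ler_nat ltn_pmod.
rewrite /cell /=; case: ifP => [_|qN] /=; rewrite in_itv /= l1 /=.
  exact: le_trans l2.
(* Here the parent is half-open. A closed fine cell is the last one, so its parent would be the last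
   as well; otherwise the strict upper bound carries over. *)
move: ct; rewrite /cell; case: ifP => [/eqP iNK|_] /=; rewrite in_itv /=.
  move: qN; suff -> : ((i %/ K).+1 == N)%N by [].
  rewrite eqn_leq parent_lt ?ltn_ord //= -(leq_pmul2r K0).
  by apply: leq_trans (ltn_ceil i K0); rewrite iNK.
by move=> /andP[_ /lt_le_trans]; apply.
Qed.

Lemma cell_refine_mesh (i : 'I_(N * K)) t t' : cell refine i t -> cell refine i t' ->
  `|t - t'| <= (b - a) / K%:R.
Proof.
move=> /cell_bounds/andP[t1 t2] /cell_bounds/andP[t1' t2'].
have := stepE i.
have qN := parent_lt (ltn_ord i).
have ha := partition_le part (leq0n (i %/ K)) (ltnW qN).
have hb := partition_le part qN (leqnn N).
have [h0 hN _] := part; rewrite h0 in ha; rewrite hN in hb.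
have : (h (i %/ K).+1 - h (i %/ K)%N) / K%:R <= (b - a) / K%:R.
  by rewrite ler_wpM2r ?invr_ge0 // lerB.
by move=> hK hs; apply/ler_normlP; split; lra.
Qed.

End Refinement.

Lemma partition_refinement (R : realType) (a b : R) (N : nat) (h : nat -> R) (d : R) :
  is_partition a b N h -> 0 < d ->
  exists N' (h' : nat -> R) (f : 'I_N' -> 'I_N),
    [/\ is_partition a b N' h',
        forall i t, cell h' i t -> cell h (f i) t &
        forall (i : 'I_N') t t', cell h' i t -> cell h' i t' -> `|t - t'| < d].
Proof.
(* The truncation plus one exceeds [(b - a) / d], so [(b - a) / K] is smaller than [d]. *)
move=> part d0; pose K := (Num.truncn ((b - a) / d)).+1.
have K0 : (0 < K)%N by [].
exists (N * K)%N, (refine h K), (@parent N K K0).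
split; first exact: refine_partition.
  by move=> i t; exact: (cell_refine_sub part K0).
move=> i t t' ct ct'; apply: le_lt_trans (cell_refine_mesh part K0 ct ct') _.
rewrite ltr_pdivrMr ?ltr0n // mulrC -ltr_pdivrMr //.
exact: truncnS_gt.
Qed.

(** * Feasibility on a fine grid *)

Section Feasibility.
Context {R : realType}.
Variables (a b : R) (mu : {measure set R -> \bar R}) (g : R -> R -> R).
Variables (n r : nat).
Variables (A : R -> 'M[R]_n) (B : R -> 'M[R]_(n, r)) (C : R -> 'M[R]_(r, n)).
Variables (gamma : R) (P Pc : R -> 'M[R]_n).
Variables (N : nat) (h : nat -> R) (hbar : 'I_N -> R) (Pd : 'I_N -> 'M[R]_n).
Variables (xi lam eps K eta m delta s cP cPc : R).

Lemma grid_feasible :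
  is_partition a b N h -> (0 < N)%N ->
  (forall i, probability_density a b mu (g (hbar i))) ->
  entrywise_measurable a b P -> 0 <= cP -> ae_bounded a b mu P cP ->
  entrywise_measurable a b Pc -> 0 <= cPc -> ae_bounded a b mu Pc cPc ->
  ae_bounded a b mu (fun l => P l - Pc l) eps ->
  (forall i l, cell h i l -> Pc l = Pd i) -> (forall i, sym_posdef (Pd i)) ->
  (forall i, [/\ spectral_norm (A (hbar i)) <= K, spectral_norm (B (hbar i)) <= K &
                 spectral_norm (P (hbar i) - Pd i) <= eps]) ->
  (forall i, [/\ sym_psd (P (hbar i) - (2 * lam)%:M), spectral_norm (Pd i) <= m &
                 sym_psd (Xi a b mu g A B C gamma P (hbar i) - xi%:M)]) ->
  0 <= xi -> 0 <= eps -> 0 < lam -> 0 <= K -> 0 <= m -> 0 < delta -> 0 < s -> 0 < eta ->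
  2 * eps <= lam -> 2 * eta <= xi -> 2 * eta <= xi * lam ^+ 2 ->
  eps * (1 + 2 * K) <= eta -> 8 * delta <= eta ->
  4 * (s ^+ 2 * (4 + 10 * m ^+ 2)) <= delta * eta ->
  2 * (s ^+ 2 * (4 + 10 * m ^+ 2)) <= delta * lam ->
  LMI_feasible mu g A B C gamma h hbar
    (fun=> s) (fun=> s) (fun=> s) (fun=> s).
Proof.
move=> part N0 gd mP cP0 Pb mPc cPc0 Pcb PPc PcPd Pd_pos good1 good2.
move=> xi0 eps0 lam0 K0 m0 delta0 s0 eta0 eps_lam.
move=> eta_xi eta_lam eps_eta delta_eta s_eta s_lam.
have Pd_sym j : (Pd j)^T = Pd j by case: (Pd_pos j).
(* The lower bound [2 * lam] of [P] at the grid points loses one [eps] on passing to [Pd], and a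
   second one on passing to [Eop P] in [E_coer]; [2 * eps <= lam] leaves [lam]. *)
have Pd_coer j x : (2 * lam - eps) * dotv x x <= dotv x (Pd j *m x).
  have [_ _ PPd] := good1 j; have [[_ /(_ x) Plx] _ _] := good2 j; move: Plx.
  rewrite dotv_form mulmxBl dotvBr mul_scalar_mx dotvZr => Plam.
  have := le_trans (ler_norm _) (dotv_le_enorm x ((P (hbar j) - Pd j) *m x)).
  rewrite mulmxBl dotvBr -mulmxBl => h1.
  have := ler_wpM2l (enorm_ge0 x) (enorm_mulmx (P (hbar j) - Pd j) x).
  rewrite mulrCA -expr2 sqr_enorm => h2.
  have := ler_wpM2r (dotvv_ge0 x) PPd; lra.
have lamd : lam <= 2 * lam - eps by lra.
have Pd_coer1 j x : lam * dotv x x <= dotv x (Pd j *m x).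
  by apply: le_trans (Pd_coer j x); rewrite ler_wpM2r ?dotvv_ge0.
pose q (i j : 'I_N) := cell_prob mu g h j (hbar i).
pose S i := \sum_(j < N) q i j *: Pd j.
have q0 i j : 0 <= q i j by exact: (cell_prob_ge0 (gd i) part).
have q1 i : \sum_j q i j = 1 by exact: (sum_cell_prob (gd i) part N0).
have S_coer i x : (2 * lam - eps) * dotv x x <= dotv x (S i *m x).
  exact: convex_comb_coercive.
have S_sym i : (S i)^T = S i by exact: convex_comb_sym.
(* [S i] is the average of [Pc] at [hbar i], so the difference is the average of [Pc - P]. *)
have SE_le i x y :
    `|dotv x ((S i - Eop a b mu g P (hbar i)) *m y)| <= eps * (enorm x * enorm y).
  rewrite /S -(Eop_piecewise (gd i) part N0 mPc cPc0 Pcb PcPd).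
  rewrite -opprB -(EopB (gd i) mP mPc cP0 cPc0 Pb Pcb) mulNmx dotvNr normrN.
  apply: (dotv_Eop_le (gd i)) => // k l.
  rewrite (_ : (fun t => _) = (fun t => P t k l) \- (fun t => Pc t k l)).
    by apply: measurable_funB; [exact: mP|exact: mPc].
  by apply/funext => t; rewrite !mxE.
have E_coer i x : lam * dotv x x <= dotv x (Eop a b mu g P (hbar i) *m x).
  have := S_coer i x; have := SE_le i x x; rewrite mulmxBl dotvBr -expr2 sqr_enorm.
  move=> /ler_normlP[_]; have := ler_wpM2r (dotvv_ge0 x) eps_lam; lra.
exists S, Pd, (fun=> delta), (fun=> delta), (fun=> delta) => i.
have [Ai Bi PPd] := good1 i; have [_ _ Xii] := good2 i.
split => //.
  have S_coer1 x : lam * dotv x x <= dotv x (S i *m x).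
    by apply: le_trans (S_coer i x); rewrite ler_wpM2r ?dotvv_ge0.
  exact: coercive_unitmx lam0 S_coer1.
have Q2 : \sum_j Num.sqrt (q i j) ^+ 2 = 1.
  by rewrite -[RHS](q1 i); apply: eq_bigr => j _; rewrite sqr_sqrtr.
have m20 : 0 <= m ^+ 2 by rewrite exprn_ge0.
rewrite /Pi1; apply: (Pi1_blocks_posdef (eta := eta) (lam := lam) (M := m ^+ 2)) => //.
- exact: tr_mxdiag_sym.
- rewrite [RHS](scalar_row_mxdiag Pd (fun j => Num.sqrt (q i j))).
  by rewrite /S; apply: eq_bigr => j _; rewrite sqr_sqrtr.
- move=> y; rewrite [LHS](scalar_row_isom (fun j => Num.sqrt (q i j))).
  by rewrite Q2 mul1r.
- by apply: convex_comb_sqr_le => // j; have [] := good2 j.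
- by apply: mxdiag_sqr_le => j; have [] := good2 j.
- exact: mxdiag_coercive.
- exact: (core_lower_bound Xii (S_sym i) xi0 eps0 lam0 K0 (E_coer i) (SE_le i)).
- exact: ltW.
Qed.

End Feasibility.

(** * Choice of the constants, of the refined grid and of its points *)

Theorem theorem4 (R : realType) (a b : R) (hab : a < b)
  (n r : nat)
  (mu : {measure set R -> \bar R})
  (nu0 : R -> R) (g : R -> R -> R)
  (d : measure_display) (Omega : measurableType d) (Pr : probability Omega R)
  (theta : nat -> {RV Pr >-> R})
  (theta_chain : markov_chain_with a b mu theta nu0 g)
  (nu0_gt0 : {ae mu, forall l, l \in `[a, b] -> 0 < nu0 l})
  (g_gt0 : {ae mu, forall l, l \in `[a, b] ->
              (0 < \int[mu]_(t in `[a, b]) (g t l)%:E)%E})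
  (A : R -> 'M[R]_n) (B : R -> 'M[R]_(n, r)) (C : R -> 'M[R]_(r, n))
  (A_Hinf : Hinf a b mu A) (B_Hinf : Hinf a b mu B) (C_Hinf : Hinf a b mu C)
  (gamma : R) (gamma_gt0 : 0 < gamma)
  (mu_lebesgue : forall S : set R, measurable S -> S `<=` `[a, b] ->
                   mu S = lebesgue_measure S)
  (A_cont : {within `[a, b], continuous A})
  (B_cont : {within `[a, b], continuous B})
  (C_cont : {within `[a, b], continuous C})
  (g_cont : {within `[a, b] `*` `[a, b],
               continuous (fun p : R * R => g p.1 p.2)})
  (P : R -> 'M[R]_n) (P_Hinf : Hinf_plus a b mu P)
  (P_sol : uniformly_posdef a b mu (Xi a b mu g A B C gamma P)) :
  exists2 eps0 : R, 0 < eps0 &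
  forall epsP : R, 0 < epsP -> epsP <= eps0 ->
  forall (N : nat) (h : nat -> R) (hbar : 'I_N -> R),
    is_grid a b h hbar ->
    (exists sA sB sC sQ : 'I_N -> R,
       grid_bounds mu g A B C h hbar sA sB sC sQ) ->
  forall (Pd : 'I_N -> 'M[R]_n) (Pc : R -> 'M[R]_n),
    (forall i, sym_posdef (Pd i)) ->
    (forall i l, cell h i l -> Pc l = Pd i) ->
    Hinf_plus a b mu Pc ->
    (normHinf a b mu (fun l => P l - Pc l)%R <= epsP%:E)%E ->
  exists (N' : nat) (h' : nat -> R) (hbar' : 'I_N' -> R)
         (sA sB sC sQ : 'I_N' -> R),
    [/\ is_grid a b h' hbar',
        grid_bounds mu g A B C h' hbar' sA sB sC sQ &
        LMI_feasible mu g A B C gamma h' hbar' sA sB sC sQ].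
Proof.
have [_ _ [dens _] _ _] := theta_chain.
have [PH P_sym [lam0 lam0_gt0 P_ge]] := P_Hinf.
have [xi xi_gt0 Xi_ge] := P_sol.
have [KA KA0 A_le] := Hinf_bounded A_Hinf.
have [KB KB0 B_le] := Hinf_bounded B_Hinf.
have [cP cP0 P_le] := Hinf_bounded PH.
pose K := Num.max KA KB.
have K0 : 0 <= K by rewrite le_max KA0.
pose lam := lam0 / 2.
have lam_gt0 : 0 < lam by rewrite divr_gt0.
pose eta := Num.min xi (xi * lam ^+ 2) / 2.
have eta_gt0 : 0 < eta by rewrite divr_gt0 // lt_min xi_gt0 mulr_gt0 // exprn_gt0.
have K1 : 0 < 1 + 2 * K by rewrite ltr_pwDl // mulr_ge0.
(* The two terms ensure [2 * eps <= lam] and [eps * (1 + 2 * K) <= eta]; both are fixed before any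
   grid or approximation is given. *)
pose eps0 := Num.min (lam / 2) (eta / (1 + 2 * K)).
exists eps0; first by rewrite lt_min; apply/andP; split; exact: divr_gt0.
move=> eps eps_gt0; rewrite le_min => /andP[eps_lam eps_eta].
move=> N h hbar [part hbarP] _ Pd Pc Pd_pos PcPd Pc_Hinf PPc.
have PPc_le := normHinf_le PPc.
have [PcH _ _] := Pc_Hinf.
have [cPc cPc0 Pc_le] := Hinf_bounded PcH.
(* Bounds [Pd], since [Pc] differs from [P] by at most [eps] at the selected points. *)
pose m := cP + eps.
have m0 : 0 <= m by rewrite addr_ge0 // ltW.
pose delta := eta / 8.
have delta_gt0 : 0 < delta by rewrite divr_gt0.
pose W := 4 + 10 * m ^+ 2.
have W_gt0 : 0 < W by rewrite ltr_pwDl // mulr_ge0 // exprn_ge0.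
pose c := Num.min (delta * eta / 4) (delta * lam / 2) / W.
have c_gt0 : 0 < c by rewrite divr_gt0 // lt_min !divr_gt0 // mulr_gt0.
(* With [s <= 1] and [s <= c], [s ^+ 2 <= c], which gives both smallness conditions on [s]. *)
pose s := Num.min 1 c.
have s_gt0 : 0 < s by rewrite lt_min ltr01.
have sW : s ^+ 2 * W <= Num.min (delta * eta / 4) (delta * lam / 2).
  rewrite -ler_pdivlMr // -/c expr2 -[leRHS]mul1r.
  by apply: ler_pM; rewrite ?(ltW s_gt0) // /s ge_min lexx ?orbT.
have ba : 0 < b - a by rewrite subr_gt0.
have [dA dA0 dAP] := mx_unif_continuous A_cont s_gt0.
have [dB dB0 dBP] := mx_unif_continuous B_cont s_gt0.
have [dC dC0 dCP] := mx_unif_continuous C_cont s_gt0.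
(* Integrating this variation of [g] over [[a, b]] gives [s ^+ 2], the bound needed on the squared
   variation of [Qmx]. *)
have s2_gt0 : 0 < s ^+ 2 / (b - a) by rewrite divr_gt0 // exprn_gt0.
have [dg dg0 dgP] := compact_unif_continuous
  (compact_setX (@segment_compact R a b) (@segment_compact R a b)) g_cont s2_gt0.
pose dl := Num.min (Num.min dA dB) (Num.min dC dg).
have dl_gt0 : 0 < dl by rewrite !lt_min dA0 dB0 dC0 dg0.
have [N' [h' [f [part' sub mesh]]]] := partition_refinement part dl_gt0.
pose good l := [/\ spectral_norm (A l) <= KA, spectral_norm (B l) <= KB,
  spectral_norm (P l) <= cP & [/\ spectral_norm (P l - Pc l) <= eps,
  sym_psd (P l - lam0%:M) & sym_psd (Xi a b mu g A B C gamma P l - xi%:M)]].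
have good_ae : {ae mu, forall l, l \in `[a, b] -> good l}.
  have : {ae mu, forall l, l \in `[a, b] -> [/\ spectral_norm (A l) <= KA,
      spectral_norm (B l) <= KB & spectral_norm (P l) <= cP]}.
    apply: filterS3 A_le B_le P_le => l g1 g2 g3 lab.
    by split; [exact: g1|exact: g2|exact: g3].
  have : {ae mu, forall l, l \in `[a, b] -> [/\ spectral_norm (P l - Pc l) <= eps,
      sym_psd (P l - lam0%:M) & sym_psd (Xi a b mu g A B C gamma P l - xi%:M)]}.
    apply: filterS3 PPc_le P_ge Xi_ge => l g1 g2 g3 lab.
    by split; [exact: g1|exact: g2|exact: g3].
  apply: filterS2 => l g2 g1 lab.
  by have [] := g1 lab; have := g2 lab; split.
have [ha' hb' hlt'] := part'.
have N'0 : (0 < N')%N.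
  case: N' ha' hb' {f part' sub mesh hlt'} => // ha' hb'.
  by move: hab; rewrite -ha' -hb' ltxx.
(* Each refined cell contains an interval of positive length, which meets the full-measure set
   [good]. *)
have pick (i : 'I_N') : exists l, (l \in `[h' i, h' i.+1[) /\ good l.
  have hi : a <= h' i by rewrite -ha'; apply: (partition_le part') => //; exact: ltnW.
  have hi1 : h' i.+1 <= b by rewrite -hb'; exact: (partition_le part').
  have [l li gl] := ae_itv_exists mu_lebesgue hi hi1 (hlt' i (ltn_ord i)) good_ae.
  by exists l.
pose hbar' i := projT1 (cid (pick i)).
have hbar_cell i : cell h' i (hbar' i).
  by apply: itv_sub_cell; rewrite /hbar'; case: cid => l [].
have hbar_good i : good (hbar' i) by rewrite /hbar'; case: cid => l [].
have hbar_ab i : hbar' i \in `[a, b] by exact: (cell_sub part' (hbar_cell i)).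
have muab : mu `[a, b]%classic = (b - a)%:E.
  by rewrite mu_lebesgue // lebesgue_measure_itv /= lte_fin hab -EFinB.
exists N', h', hbar', (fun=> s), (fun=> s), (fun=> s), (fun=> s); split.
- by split.
- move=> i; split => //; apply: aeW => l li.
  have lab := cell_sub part' li.
  have := mesh _ _ _ li (hbar_cell i).
  rewrite !lt_min => /andP[/andP[lA lB] /andP[lC lg]].
  split; [exact: dAP|exact: dBP|exact: dCP|].
  have -> : Qmx mu g n N' h' l - Qmx mu g n N' h' (hbar' i) =
    scalar_row n (fun j => Num.sqrt (cell_prob mu g h' j l)
                         - Num.sqrt (cell_prob mu g h' j (hbar' i))).
    rewrite -mxrowB; apply: eq_mxrow => j; by rewrite raddfB.
  apply: scalar_row_norm; first exact: ltW.
  rewrite -[leRHS](divfK (lt0r_neq0 ba)).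
  apply: sum_sqrt_cell_prob_le => //; try exact: dens.
  move=> t tab; apply/ltW.
  by apply: (dgP (l, t) (hbar' i, t)) => //; split => //=; exact: ballxx.
have eps_eta' : eps * (1 + 2 * K) <= eta by rewrite -ler_pdivlMr.
(* Each refined cell inherits the matrix of the cell of [h] that contains it, hence [Pd \o f]. *)
apply: (grid_feasible (P := P) (Pc := Pc) (Pd := Pd \o f) (xi := xi) (lam := lam)
  (eps := eps) (K := K) (eta := eta) (m := m) (delta := delta) (cP := cP) (cPc := cPc)
  part') => //.
- by move=> i; exact: dens.
- by case: PH.
- by case: PcH.
- by move=> i l /sub /PcPd.
- by move=> i; exact: Pd_pos.
- move=> i; have [Ai Bi _ [PPci _ _]] := hbar_good i.
  rewrite /= -(PcPd _ _ (sub _ _ (hbar_cell i))).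
  by split=> //; rewrite le_max ?Ai ?Bi ?orbT.
- move=> i; have [_ _ Pi [PPci Pge Xii]] := hbar_good i; split => //.
    by rewrite /lam mulrCA divff // mulr1.
  rewrite /= -(PcPd _ _ (sub _ _ (hbar_cell i))).
  have -> : Pc (hbar' i) = P (hbar' i) + - (P (hbar' i) - Pc (hbar' i)).
    by rewrite opprB addrC subrK.
  by apply: le_trans (spectral_normD _ _) _; rewrite spectral_normN lerD.
- exact: ltW.
- exact: ltW.
- by move: eps_lam; rewrite ler_pdivlMr // mulrC.
- by rewrite /eta mulrC divfK // ge_min lexx.
- by rewrite /eta mulrC divfK // ge_min lexx orbT.
- by rewrite /delta mulrC divfK.
- rewrite mulrC -ler_pdivlMr //; apply: le_trans sW _; by rewrite ge_min lexx.
- rewrite mulrC -ler_pdivlMr //; apply: le_trans sW _; by rewrite ge_min lexx orbT.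
Qed.
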